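(* Consider the family of It\^o stochastic linear systems with additive Poisson jump noise, indexed by $\beta\in K$, $$\mathrm{d}X(t,\beta)=A(t,\beta)X(t,\beta)\,\mathrm{d}t+B(t,\beta)u(t)\,\mathrm{d}t+G(t,\beta)\,\mathrm{d}N(t),$$ with $A\in L_\infty^{n\times n}(D)$, $B\in L_2^{n\times m}(D)$, $G\in L_2^{n\times k}(D)$, $D=[0,T]\times K$, where $N$ is a vector of Poisson counters with vector of constant intensities $\lambda\in\mathbb{R}^k$. Let $X_0,X_F\in\mathcal{H}_K$. Then the control $u\in\mathcal{H}_T$ which minimizes $$\mathcal{J}_1=\|\mathcal{E}X_T-X_F\|_K,$$ the error in the mean of the terminal state, while steering the system from the initial state $X(0,\beta)=X_0(\beta)$ to the target state $X(T,\beta)=X_F(\beta)$, must satisfy $$\int_0^{T}\Phi(0,\sigma,\beta)\bigl(B(\sigma,\beta)u(\sigma)+G(\sigma,\beta)\lambda\bigr)\,\mathrm{d}\sigma=\Phi(0,T,\beta)X_F(\beta)-X_0(\beta)$$ (as an equation between functions of $\beta\in K$).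
   Context: Setting: $T>0$; $K\subset\mathbb{R}$ is compact; $D=[0,T]\times K\subset\mathbb{R}^2$; the state $X$ takes values in $M\subset\mathbb{R}^n$, and the control $u:[0,T]\to U\subset\mathbb{R}^m$ is open-loop, i.e. a function of $t$ only, the same for all $\beta$ and all realizations of the noise. $A\in L_\infty^{n\times n}(D)$, $B\in L_2^{n\times m}(D)$, $G\in L_2^{n\times k}(D)$ mean that $A(t,\beta)\in\mathbb{R}^{n\times n}$, $B(t,\beta)\in\mathbb{R}^{n\times m}$, $G(t,\beta)\in\mathbb{R}^{n\times k}$ have entries that are real $L_\infty(D)$, $L_2(D)$, $L_2(D)$ functions, respectively. $N:[0,T]\times\Xi\to\mathbb{R}^k$ is a vector-valued process whose components are independent Poisson counters on a probability space $(\Xi,\mathcal{G},\mathbb{N})$ with its natural filtration, with vector $\lambda\in\mathbb{R}^k$ of constant intensities, so that $\mathcal{E}N(t)=\lambda t$ and $\mathrm{Cov}(N(t),N(s))=\Lambda\min(t,s)$, where $\Lambda=\mathrm{diag}(\lambda)$ is the diagonal matrix with the entries of $\lambda$ on its diagonal. $\mathcal{E}$ denotes expectation with respect to $\mathbb{N}$, and $'$ denotes transpose. The argument $\xi\in\Xi$ of $X$ and $N$ is suppressed. Function spaces: $\mathcal{H}_T=L_2^m[0,T]$ is the Hilbert space of square-integrable $\mathbb{R}^m$-valued functions on $[0,T]$ with inner product $\langle g,h\rangle_T=\int_0^T g'(t)h(t)\,\mathrm{d}t$. $\mathcal{H}_K=L_2^n(K)$ is the Hilbert space of square-integrable $\mathbb{R}^n$-valued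 functions on $K$ with inner product $\langle p,q\rangle_K=\int_K p'(\beta)q(\beta)\,\mathrm{d}\mu(\beta)$, $\mu$ being Lebesgue measure, and induced norm $\|\cdot\|_K$. $X_T(\beta)=X(T,\beta)$ is the terminal state. The initial and target states $X_0,X_F$ are (non-random) elements of $\mathcal{H}_K$. $\mathcal{J}_1=\left(\int_K\|\mathcal{E}X_T(\beta)-X_F(\beta)\|_2^2\,\mathrm{d}\mu(\beta)\right)^{1/2}$, where $\|\cdot\|_2$ is the Euclidean norm. Steering the stochastic ensemble between states in $\mathcal{H}_K$ by an open-loop control refers to steering its instantaneous expected state $\mathcal{E}X$. $\Phi(t,s,\beta)$ denotes the transition matrix (from time $s$ to time $t$) of the homogeneous system $\dot X(t,\beta)=A(t,\beta)X(t,\beta)$. *)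

(* Defs.v *)
From HB Require Import structures.
From mathcomp Require Import all_boot all_order all_algebra.
From mathcomp Require Import all_classical all_reals all_analysis.

Set Implicit Arguments.
Unset Strict Implicit.
Unset Printing Implicit Defensive.

Import Order.TTheory GRing.Theory Num.Theory.
Import numFieldNormedType.Exports.

Local Open Scope classical_set_scope.
Local Open Scope ring_scope.

Section function_spaces.
Context {R : realType}.

Definition lebesgue2 := (@lebesgue_measure R \x @lebesgue_measure R)%E.

(* The (matrix-valued) elements of L_p over a domain are given by Borel
   representatives; only their values on the domain matter, since the entries
   are extended by 0 outside of it. *)
Definition Lp_itv (p : \bar R) (T : R) (r c : nat) (f : R -> 'M[R]_(r, c)) :=
  forall i j, ((fun t => f t i j) \_ `[0, T]) \in Lfun (@lebesgue_measure R) p.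

Definition Lp_params (p : \bar R) (K : set R) (r c : nat)
    (f : R -> 'M[R]_(r, c)) :=
  forall i j, ((fun b => f b i j) \_ K) \in Lfun (@lebesgue_measure R) p.

Definition Lp_domain (p : \bar R) (T : R) (K : set R) (r c : nat)
    (f : R -> R -> 'M[R]_(r, c)) :=
  forall i j,
    ((fun z : R * R => f z.1 z.2 i j) \_ (`[0, T] `*` K)) \in Lfun lebesgue2 p.

(* The library's norm on matrices is the sup norm. *)
Definition norm2 (n : nat) (v : 'cV[R]_n) : R :=
  Num.sqrt (\sum_(i < n) v i 0 ^+ 2).

Definition mx_integrable (r c : nat) (D : set R) (f : R -> 'M[R]_(r, c)) :=
  forall i j,
    (@lebesgue_measure R).-integrable D (EFin \o (fun s => f s i j)).

(* Oriented: the integral from s to t is minus the one from t to s. *)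
Definition mx_int (r c : nat) (s t : R) (f : R -> 'M[R]_(r, c)) :
    'M[R]_(r, c) :=
  \matrix_(i, j)
    ((\int[@lebesgue_measure R]_(x in `]s, t]) f x i j)
     - (\int[@lebesgue_measure R]_(x in `]t, s]) f x i j)).

(* Absolutely continuous fundamental solution: A is only essentially bounded,
   so the homogeneous system is meant in integral form, for a.e. b. *)
Definition transition_matrix (T : R) (K : set R) (n : nat)
    (A : R -> R -> 'M[R]_n) (Phi : R -> R -> R -> 'M[R]_n) :=
  \forall b \ae @lebesgue_measure R, K b ->
    forall s, s \in `[0, T] ->
      mx_integrable `[0, T] (fun x => A x b *m Phi x s b) /\
      forall t, t \in `[0, T] ->
        Phi t s b = 1%:M + mx_int s t (fun x => A x b *m Phi x s b).

End function_spaces.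

Section poisson_counters.
Context {R : realType} {d : measure_display} {Xi : measurableType d}.
Variable P : probability Xi R.

(* When each F i contains the full event, this is mutual independence of the
   family: the product rule over subfamilies is obtained by E i = setT. *)
Definition mutually_independent (I : finType) (F : I -> set (set Xi)) :=
  forall E : I -> set Xi, (forall i, F i (E i)) ->
    P (\bigcap_(i in [set: I]) E i) = (\prod_(i in I) P (E i))%E.

Definition events_of (Y : Xi -> R) : set (set Xi) :=
  preimage_set_system setT Y measurable.

(* A trajectory is bundled as a nondecreasing right-continuous function, so
   that it induces a Lebesgue-Stieltjes measure; only its values on [0, T]
   are constrained or used. *)
Definition poisson_counter (T : R) (lambda : R) (N : Xi -> cumulative R R) :=
  [/\ 0 <= lambda,
      forall t, t \in `[0, T] -> measurable_fun setT (fun xi => N xi t),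
      forall xi, N xi 0 = 0 /\
        forall t, t \in `[0, T] -> N xi t \is a Num.nat,
      forall s t, 0 <= s -> s <= t -> t <= T -> forall j : nat,
        P [set xi | N xi t - N xi s = j%:R] =
          ((lambda * (t - s)) ^+ j / j`!%:R * expR (- (lambda * (t - s))))%:E &
      forall (r : nat) (t : nat -> R), nondecreasing_seq t ->
        (forall j, t j \in `[0, T]) ->
        mutually_independent
          (fun j : 'I_r => events_of (fun xi => N xi (t j.+1) - N xi (t j)))].

Definition history (N : Xi -> cumulative R R) (t : R) : set (set Xi) :=
  \bigcup_(s in `[0, t]) events_of (fun xi => N xi s).

Definition poisson_counters (T : R) (k : nat) (lambda : 'cV[R]_k)
    (N : 'I_k -> Xi -> cumulative R R) :=
  (forall i, poisson_counter T (lambda i 0) (N i)) /\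
  mutually_independent (fun i : 'I_k => <<s history (N i) T >>).

Definition natural_filtration (k : nat) (N : 'I_k -> Xi -> cumulative R R)
    (t : R) : set (set Xi) :=
  <<s \bigcup_(i in [set: 'I_k]) history (N i) t >>.

(* Adaptedness to the P-augmented natural filtration. *)
Definition adapted_at (k : nat) (N : 'I_k -> Xi -> cumulative R R) (t : R)
    (Y : Xi -> R) :=
  forall E, events_of Y E -> measurable E /\
    exists2 F, natural_filtration N t F & P.-negligible (E `+` F).

(* The integrand is deterministic and the integrator has bounded variation:
   the stochastic integral over ]0, t] is a pathwise Lebesgue-Stieltjes
   integral, i.e. the sum of the values of g at the jump times. *)
Definition jump_int (n k : nat) (N : 'I_k -> Xi -> cumulative R R) (xi : Xi)
    (t : R) (g : R -> 'M[R]_(n, k)) : 'cV[R]_n :=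
  \col_i \sum_(j < k)
    \int[lebesgue_stieltjes_measure (N j xi)]_(s in `]0, t]) g s i j.

End poisson_counters.

Section ensemble.
Context {R : realType} {d : measure_display} {Xi : measurableType d}.
Variables (P : probability Xi R) (n m k : nat) (T : R) (K : set R).
Variables (M : set 'cV[R]_n) (U : set 'cV[R]_m).
Variables (A : R -> R -> 'M[R]_n) (B : R -> R -> 'M[R]_(n, m)).
Variables (G : R -> R -> 'M[R]_(n, k)) (N : 'I_k -> Xi -> cumulative R R).
Variables (X0 XF : R -> 'cV[R]_n).

Definition control (u : R -> 'cV[R]_m) :=
  Lp_itv 2%:E T u /\ forall t, t \in `[0, T] -> U (u t).

(* X t b xi : strong solution of the Ito system, in integral form.  Off a null set of
   parameters the coefficients need not be integrable in time, hence the a.e. b. *)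
Definition ensemble_solution (u : R -> 'cV[R]_m)
    (X : R -> R -> Xi -> 'cV[R]_n) :=
  \forall b \ae @lebesgue_measure R, K b ->
    (forall t i, t \in `[0, T] -> adapted_at P N t (fun xi => X t b xi i 0)) /\
    \forall xi \ae P,
      mx_integrable `[0, T] (fun s => A s b *m X s b xi + B s b *m u s) /\
      forall t, t \in `[0, T] ->
        M (X t b xi) /\
        X t b xi = X0 b + mx_int 0 t (fun s => A s b *m X s b xi + B s b *m u s)
                   + jump_int N xi t (fun s => G s b).

(* For a solution the expectation is finite for a.e. b, so fine loses nothing. *)
Definition mean_state (X : R -> R -> Xi -> 'cV[R]_n) (t b : R) : 'cV[R]_n :=
  \col_i fine ('E_P[fun xi => X t b xi i 0%R])%E.

Definition J1 (X : R -> R -> Xi -> 'cV[R]_n) : \bar R :=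
  ((\int[@lebesgue_measure R]_(b in K)
      ((norm2 (mean_state X T b - XF b)) ^+ 2)%:E) `^ 2^-1)%E.

(* The state driven by u from X0 meets the target XF in expectation. *)
Definition steers (u : R -> 'cV[R]_m) (X : R -> R -> Xi -> 'cV[R]_n) :=
  [/\ control u, ensemble_solution u X &
      \forall b \ae @lebesgue_measure R, K b -> mean_state X T b = XF b].

Definition minimizes_J1_steering (u : R -> 'cV[R]_m)
    (X : R -> R -> Xi -> 'cV[R]_n) :=
  steers u X /\ forall v Y, steers v Y -> (J1 X <= J1 Y)%E.

End ensemble.

(* Main.v *)
(** Fix a parameter [b] outside a null set and write [F t = Phi t 0 b],
    [V s = Phi 0 s b].  Uniqueness for the homogeneous equation (Gronwall with
    the weight [exp (- L t)]) gives [F s *m V s = 1], so [V] is continuous on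
    [[0, T]].  Along each path [xi], Fubini shows that
    [F t *m (X0 + int_0^t V B u ds + int_0^t V G dN)] solves the same integral
    equation as [X t b xi], hence both agree by uniqueness.  Taking expectations
    of this identity at [t = T] with Campbell's formula
    [E (int_0^T g dN) = lambda int_0^T g ds], and using that the mean terminal
    state is [XF], gives the claim.  Working path by path avoids any joint
    measurability of [X] in [(t, xi)]. *)

Require Import Defs.
From HB Require Import structures.
From mathcomp Require Import all_boot all_order all_algebra.
From mathcomp Require Import all_classical all_reals all_analysis.
From mathcomp Require Import measurable_realfun ess_sup_inf.
From mathcomp Require Import ring lra.
Import Order.TTheory GRing.Theory Num.Theory.
Import numFieldNormedType.Exports.
Local Open Scope classical_set_scope.
Local Open Scope ring_scope.

Set Implicit Arguments.
Unset Strict Implicit.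

(** * Campbell's formula *)

(** Paths jump and the coefficients are merely measurable in time, so nothing is differentiated: the
    state is compared with an explicit candidate and every equation stays in integral form. The
    price is one exchange of integrals per forcing term, over the triangle [0 < r <= s <= t], with
    Lebesgue measure in [s] and either Lebesgue or a jump measure in [r]. [transition_matrix] gives,
    for each fixed [s], an equation in [t]; how [Phi 0 s b] varies with [s] is left open. Yet this
    function of [s] is integrated against the control term and against the jumps, so its
    measurability and boundedness have to be derived, from its being the inverse of the continuous
    [Phi s 0 b]. A solution comes with integrability of [A X + B u] but with no bound on [X].
    Uniqueness is therefore stated for differences [D] with [A D] integrable, and boundedness of [D]
    is extracted from the equation itself. *)

Section mean_measure.
Local Open Scope ereal_scope.
Context d d' (Xi : measurableType d) (Y : measurableType d') (R : realType).
Variables (P : {measure set Xi -> \bar R}) (nu : {measure set Y -> \bar R}).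
Variable kappa : Xi -> {measure set Y -> \bar R}.

(* [kappa] is a random measure with mean measure [nu]: by the pi-lambda theorem,
   measurability and the mean need only be checked on a generating pi-system. *)
Lemma mean_measure_g_sigma_algebra (G : set (set Y)) :
  measurable = <<s G >> -> setI_closed G -> nu setT < +oo ->
  (forall xi, kappa xi setT < +oo) ->
  (forall U, (G U \/ U = setT) -> measurable_fun [set: Xi] (kappa ^~ U : Xi -> \bar R) /\
     nu U = \int[P]_xi kappa xi U) ->
  forall U, measurable U -> measurable_fun [set: Xi] (kappa ^~ U : Xi -> \bar R) /\
     nu U = \int[P]_xi kappa xi U.
Proof.
move=> mG GI nuoo koo HG.
pose H := [set U | measurable U /\ (measurable_fun [set: Xi] (kappa ^~ U : Xi -> \bar R) /\
     nu U = \int[P]_xi kappa xi U)].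
suff : measurable `<=` H by move=> + U => /[apply] -[].
(* [setT] need not belong to the pi-system, hence its separate place in the hypothesis. Complements
   are handled by subtracting from its mass, which is finite. *)
have HT : H setT by split => //; apply: HG; right.
rewrite mG; apply: lambda_system_subset => //; last first.
  by move=> U GU; split; [rewrite mG; exact: sub_sigma_algebra|apply: HG; left].
apply/dynkin_lambda_system; split => //.
- move=> U [mU [kU nuU]]; split; first exact: measurableC.
  have kCE xi : kappa xi (~` U) = kappa xi setT - kappa xi U.
    rewrite -setTD measureD//; last exact: koo. by rewrite setTI.
  have kTU xi : kappa xi U <= kappa xi setT by apply: le_measure; rewrite ?inE.
  split.
    rewrite (_ : kappa ^~ _ = (fun xi => kappa xi setT - kappa xi U)).
      by apply: emeasurable_funB => //; case: HT => _ [].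
    exact/funext.
  rewrite -setTD measureD//= setTI nuU.
  have [_ [kT nuT]] := HT.
  rewrite nuT -integralB//; last 2 first.
  - apply/integrableP; split => //.
    by under eq_integral do rewrite gee0_abs//; rewrite -nuT.
  - apply/integrableP; split => //.
    under eq_integral do rewrite gee0_abs//.
    rewrite -nuU (le_lt_trans _ nuoo)//.
    by apply: le_measure; rewrite ?inE.
  - by apply: eq_integral => xi _; rewrite setTD kCE.
- move=> F tF HF; have mF k : measurable (F k) by case: (HF k).
  have kE xi : kappa xi (\bigcup_k F k) = \sum_(k <oo) kappa xi (F k).
    by rewrite measure_bigcup//; apply: eq_eseriesl => k; rewrite in_setT.
  split; first exact: bigcupT_measurable.
  split.
    under eq_fun do rewrite kE.
    by apply: ge0_emeasurable_sum => // k _; case: (HF k) => _ [].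
  under eq_integral do rewrite kE.
  rewrite integral_nneseries//; last by move=> k; case: (HF k) => _ [].
  rewrite measure_bigcup//.
  rewrite (eq_eseriesl (Q := xpredT)); last by move=> k; rewrite in_setT.
  by apply: eq_eseriesr => k _; case: (HF k) => _ [].
Qed.

Hypothesis mkappa : forall U, measurable U -> measurable_fun [set: Xi] (kappa ^~ U : Xi -> \bar R).
Hypothesis nuE : forall U, measurable U -> nu U = \int[P]_xi kappa xi U.

Import HBNNSimple.

Let integral_mean_nnsfun (f : {nnsfun Y >-> R}) :
  \int[nu]_y (f y)%:E = \int[P]_xi \int[kappa xi]_y (f y)%:E.
Proof.
have E (mu : {measure set Y -> \bar R}) : \int[mu]_y (f y)%:E =
    \sum_(r \in range f) r%:E * mu (f @^-1` [set r]).
  rewrite [RHS](_ : _ = sintegral mu f); last by rewrite sintegralE.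
  by rewrite -integralT_nnsfun.
rewrite E; under eq_integral do rewrite E.
rewrite ge0_integral_fsum//=; last 2 first.
  - by move=> r; apply: measurable_funeM; exact: mkappa.
  - by move=> r xi _; exact: nnsfun_mulemu_ge0.
apply: eq_fsbigr => r _; rewrite nuE//.
have [r0|r0] := leP 0%R r; first by rewrite ge0_integralZl//; exact: mkappa.
rewrite preimage_nnfun0//.
by rewrite !integral0_eq ?mule0// => xi _; rewrite measure0 ?mule0.
Qed.

(** Monotone convergence along simple functions, applied under [nu], under each [kappa xi], and once
    more under [P]. *)
Lemma ge0_integral_mean_measure (f : Y -> \bar R) : (forall y, 0 <= f y) ->
  measurable_fun setT f -> \int[nu]_y f y = \int[P]_xi \int[kappa xi]_y f y.
Proof.
move=> f0 mf; pose f_ := nnsfun_approx measurableT mf.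
have mc (mu : {measure set Y -> \bar R}) :
    \int[mu]_y f y = limn (fun n => \int[mu]_y (f_ n y)%:E).
  rewrite -monotone_convergence//.
  - by apply: eq_integral => z _; apply/esym/cvg_lim => //=; exact: cvg_nnsfun_approx.
  - by move=> n; exact/measurable_EFinP.
  - by move=> n z _; rewrite lee_fin.
  - by move=> z _ a b ab; rewrite lee_fin; exact/lefP/nd_nnsfun_approx.
rewrite mc; under eq_fun do rewrite integral_mean_nnsfun.
rewrite -monotone_convergence//; first by apply: eq_integral => xi _; rewrite mc.
- move=> n; apply: measurable_fun_integral_kernel => //.
  + by move=> z; rewrite lee_fin.
  + exact/measurable_EFinP.
- by move=> n y _; apply: integral_ge0 => // z _; rewrite lee_fin.
- move=> y _ a b ab; apply: ge0_le_integral => //.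
  + by move=> z _; rewrite lee_fin.
  + exact/measurable_EFinP.
  + exact/measurable_EFinP.
  + by move=> z _; rewrite lee_fin; exact/lefP/nd_nnsfun_approx.
Qed.

(** The nonnegative case for [|f|] makes [f] integrable for almost every [xi]. The positive and
    negative parts then have [P]-integrable integrals, so their difference can be integrated term by
    term. *)
Lemma integrable_mean_measure (f : Y -> \bar R) : nu.-integrable setT f ->
  [/\ {ae P, forall xi, (kappa xi).-integrable setT f},
      P.-integrable setT (fun xi => \int[kappa xi]_y f y) &
      \int[P]_xi \int[kappa xi]_y f y = \int[nu]_y f y].
Proof.
move=> /[dup] fi /integrableP[mf foo].
have mfabs : measurable_fun setT (fun xi => \int[kappa xi]_y `|f y|).
  by apply: measurable_fun_integral_kernel => //; exact: measurableT_comp.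
have iabs : P.-integrable setT (fun xi => \int[kappa xi]_y `|f y|).
  apply/integrableP; split => //.
  under eq_integral do rewrite gee0_abs ?integral_ge0//.
  by rewrite -ge0_integral_mean_measure//; exact: measurableT_comp.
have mp : measurable_fun setT (fun xi => \int[kappa xi]_y f^\+ y).
  by apply: measurable_fun_integral_kernel => //; exact: measurable_funepos.
have mn : measurable_fun setT (fun xi => \int[kappa xi]_y f^\- y).
  by apply: measurable_fun_integral_kernel => //; exact: measurable_funeneg.
have ip : P.-integrable setT (fun xi => \int[kappa xi]_y f^\+ y).
  apply: (le_integrable _ mp _ iabs) => // xi _.
  rewrite !gee0_abs ?integral_ge0//; apply: ge0_le_integral => //.
  - exact: measurable_funepos.
  - exact: measurableT_comp.
  - by move=> y _; rewrite -/((abse \o f) y) fune_abse leeDl.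
have im : P.-integrable setT (fun xi => \int[kappa xi]_y f^\- y).
  apply: (le_integrable _ mn _ iabs) => // xi _.
  rewrite !gee0_abs ?integral_ge0//; apply: ge0_le_integral => //.
  - exact: measurable_funeneg.
  - exact: measurableT_comp.
  - by move=> y _; rewrite -/((abse \o f) y) fune_abse leeDr.
have kE : (fun xi => \int[kappa xi]_y f y) =
    (fun xi => \int[kappa xi]_y f^\+ y) \- (fun xi => \int[kappa xi]_y f^\- y).
  by apply/funext => xi; rewrite integralE.
split.
- have := integrable_ae measurableT iabs.
  apply: filterS => xi /(_ Logic.I) fin; apply/integrableP; split => //.
  by rewrite -ge0_fin_numE// integral_ge0.
- by rewrite kE; exact: integrableB.
- rewrite kE integralB// [RHS]integralE.
  rewrite -!ge0_integral_mean_measure//.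
  + exact: measurable_funeneg.
  + exact: measurable_funepos.
Qed.

End mean_measure.

Section poisson_campbell.
Context (R : realType).
Local Notation leb := (@lebesgue_measure R).

Lemma lebesgue_stieltjes_measure_itvoc (f : cumulative R R) (a b : R) :
  a <= b -> lebesgue_stieltjes_measure f `]a, b]%classic = (f b - f a)%:E.
Proof.
move=> ab; rewrite /lebesgue_stieltjes_measure/= /measure_extension/=.
rewrite measurable_mu_extE//; last exact: is_ocitv.
exact: wlength_itv_bnd.
Qed.

(** The term [j = 0] vanishes and [j / j! = 1 / (j - 1)!], so the shifted partial sums are
    [a exp(-a)] times those of the exponential series. *)
Lemma poisson_mean (a : R) : 0 <= a ->
  (\sum_(j <oo) (j%:R * (a ^+ j / j`!%:R * expR (- a)))%:E = a%:E)%E.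
Proof.
move=> a0; apply/cvg_lim => //; rewrite -cvg_shiftS.
rewrite (_ : [sequence _]_n = EFin \o (fun n => a * expR (- a) * series (exp_coeff a) n)).
  apply: cvg_EFin; first by near=> n.
  rewrite [X in _ --> X](_ : a = a * expR (- a) * expR a); last first.
    by rewrite -mulrA expRN mulVf ?mulr1// gt_eqF// expR_gt0.
  by apply: cvgMl_tmp; exact: is_cvg_series_exp_coeff.
apply/funext => n /=; rewrite sumEFin; congr (_%:E).
rewrite big_nat_recl//= mul0r add0r /series/= mulr_sumr; apply: eq_bigr => i _.
rewrite factS natrM exprS invfM /exp_coeff/=.
have i0 : (i.+1%:R : R) != 0 by rewrite pnatr_eq0.
move: i0; move: (i.+1%:R : R) (i`!%:R^-1 : R) (a ^+ i) => c v b c0.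
have -> : c * (a * b * (c^-1 * v) * expR (- a)) =
    c / c * (a * b * v * expR (- a)) by ring.
by rewrite divff//; ring.
Unshelve. all: by end_near. Qed.

Lemma integral_nat_valued d (Xi : measurableType d) (P : {measure set Xi -> \bar R})
    (Y : Xi -> R) : measurable_fun setT Y -> (forall xi, Y xi \is a Num.nat) ->
  (\int[P]_xi (Y xi)%:E =
    \sum_(j <oo) j%:R%:E * P [set xi | Y xi = j%:R])%E.
Proof.
move=> mY Ynat.
pose F (j : nat) := [set xi | Y xi = j%:R].
have mF j : measurable (F j).
  rewrite (_ : F j = setT `&` Y @^-1` [set j%:R]).
    exact: (mY measurableT [set j%:R] (measurable_set1 _)).
  by rewrite setTI.
have FT : \bigcup_j F j = setT.
  by apply/seteqP; split => // xi _; have /natrP[j Yj] := Ynat xi; exists j.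
rewrite -[in LHS]FT ge0_integral_bigcup//=.
- apply: eq_eseriesr => j _.
  rewrite (eq_integral (cst j%:R%:E)) ?integral_cst//.
  by move=> xi; rewrite inE /F/= => ->.
- by rewrite FT; exact/measurable_EFinP.
- by move=> xi _; have /natrP[j ->] := Ynat xi; rewrite lee_fin.
- apply/trivIsetP => i j _ _ ij; rewrite -subset0 => xi [/= Yi].
  by rewrite /F/= Yi => /eqP; rewrite eqr_nat (negbTE ij).
Qed.


(** Turns an integral over [D] into one over the whole space, the setting of the mean measure
    lemmas. *)
Lemma integral_mrestr d (Y : measurableType d) (mu : {measure set Y -> \bar R})
    (D : set Y) (mD : measurable D) (f : Y -> \bar R) :
  (\int[mrestr mu mD]_y (f \_ D) y = \int[mu]_(y in D) f y)%E.
Proof.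
rewrite -integral_mkcond; apply: eq_measure_integral => A mA AD.
by rewrite /= /mrestr setIidl.
Qed.

Lemma integrable_mrestr d (Y : measurableType d) (mu : {measure set Y -> \bar R})
    (D : set Y) (mD : measurable D) (f : Y -> \bar R) :
  (mrestr mu mD).-integrable setT (f \_ D) <-> mu.-integrable D f.
Proof.
have E : (\int[mrestr mu mD]_y `|(f \_ D) y| = \int[mu]_(y in D) `|f y|)%E.
  by rewrite -(integral_mrestr mu mD); apply: eq_integral => y _; rewrite -/((abse \o _) y) -restrict_abse.
split=> /integrableP[mf foo]; apply/integrableP.
  by split; [exact/(measurable_restrictT _ mD)|rewrite -E].
by split; [exact/(measurable_restrictT _ mD)|rewrite E].
Qed.

Lemma integrable_mscale d (Y : measurableType d) (mu : {measure set Y -> \bar R})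
    (k : {nonneg R}) (f : Y -> \bar R) :
  mu.-integrable setT f -> (mscale k mu).-integrable setT f.
Proof.
move=> /integrableP[mf foo]; apply/integrableP; split => //.
rewrite ge0_integral_mscale//; last exact: measurableT_comp.
by rewrite lte_mul_pinfty.
Qed.

Lemma integral_mscale d (Y : measurableType d) (mu : {measure set Y -> \bar R})
    (k : {nonneg R}) (f : Y -> \bar R) : mu.-integrable setT f ->
  (\int[mscale k mu]_y f y = k%:num%:E * \int[mu]_y f y)%E.
Proof.
move=> fi; have mf := measurable_int mu fi.
rewrite [LHS]integralE (integralE mu).
rewrite ge0_integral_mscale//; last exact: measurable_funepos.
rewrite ge0_integral_mscale//; last exact: measurable_funeneg.
by rewrite [RHS]muleBr// fin_num_adde_defl// fin_numN integrable_neg_fin_num.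
Qed.

Section campbell.
Context d (Xi : measurableType d) (P : probability Xi R).
Variables (T lambda : R) (N : Xi -> cumulative R R).
Hypotheses (T0 : 0 <= T) (NP : poisson_counter P T lambda N).

Let mD : measurable (`]0, T] : set R). Proof. exact: measurable_itv. Qed.

Let kappa xi : {measure set (measurableTypeR R) -> \bar R} :=
  mrestr (lebesgue_stieltjes_measure (N xi)) mD.

Let lambda0 : 0 <= lambda. Proof. by case: NP. Qed.

Let nu : {measure set (measurableTypeR R) -> \bar R} :=
  mscale (NngNum lambda0) (mrestr leb mD).

Let itvE (a b : R) : `]a, b]%classic `&` `]0, T]%classic =
  `]Num.max a 0, Num.min b T]%classic.
Proof.
apply/seteqP; split => x /=; rewrite !in_itv/= gt_max le_min.
  by move=> [/andP[-> ->] /andP[-> ->]].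
by move=> /andP[/andP[-> ->] /andP[-> ->]].
Qed.

Let mN t : t \in `[0, T] -> measurable_fun setT (fun xi => N xi t).
Proof. by case: NP => _ + _ _ _; exact. Qed.

Let EN (s t : R) : 0 <= s -> s <= t -> t <= T ->
  (\int[P]_xi (N xi t - N xi s)%:E = (lambda * (t - s))%:E)%E.
Proof.
move=> s0 st tT; case: NP => _ _ Nnat Npois _.
have sT : s \in `[0, T] by rewrite in_itv/= s0 (le_trans st tT).
have tT' : t \in `[0, T] by rewrite in_itv/= tT (le_trans s0 st).
rewrite integral_nat_valued.
- rewrite -poisson_mean ?mulr_ge0 ?subr_ge0//; apply: eq_eseriesr => j _.
  by rewrite EFinM; congr (_ * _)%E; exact: Npois.
- by apply: measurable_funB; exact: mN.
(* The increment is a natural number because the counter is nondecreasing with natural values; its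
   mean is thus a sum over the Poisson weights. *)
- move=> xi; have [_ Nn] := Nnat xi.
  have /natrP[i Ns] := Nn _ sT; have /natrP[j Nt] := Nn _ tT'.
  have : N xi s <= N xi t by exact: cumulative_is_nondecreasing.
  by rewrite Ns Nt ler_nat => ij; rewrite -natrB// natr_nat.
Qed.

(* Outside of [0, T] nothing is known about [N], hence the restriction of both
   measures to ]0, T]. *)
Let kappa_mean U : measurable U ->
  measurable_fun setT (fun xi => kappa xi U) /\
  nu U = (\int[P]_xi kappa xi U)%E.
Proof.
have nuE V : nu V = (lambda%:E * leb (V `&` `]0%R, T]%classic))%E by [].
have kappaE xi V : kappa xi V =
  lebesgue_stieltjes_measure (N xi) (V `&` `]0, T]%classic) by [].
have lebE (a b : R) : a <= b -> leb `]a, b]%classic = (b - a)%:E.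
  exact: (@lebesgue_stieltjes_measure_itvoc idfun).
have kI (a b : R) : measurable_fun setT (fun xi => kappa xi `]a, b]%classic) /\
    nu `]a, b]%classic = (\int[P]_xi kappa xi `]a, b]%classic)%E.
  rewrite nuE; under eq_fun do rewrite kappaE.
  rewrite itvE.
  set s := Num.max a 0; set t := Num.min b T.
  have [st|ts] := leP s t; last first.
    have -> : `]s, t]%classic = set0 :> set R.
      by rewrite set_itv_ge// bnd_simp -leNgt ltW.
    rewrite measure0 mule0; under eq_fun do rewrite measure0.
    split; first exact: measurable_cst.
    by rewrite integral0_eq// => xi _; rewrite measure0.
  have s0 : 0 <= s by rewrite le_max lexx orbT.
  have tT : t <= T by rewrite ge_min lexx orbT.
  split.
    under eq_fun do rewrite lebesgue_stieltjes_measure_itvoc//.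
    apply/measurable_EFinP; apply: measurable_funB; apply: mN.
      by rewrite in_itv/= tT (le_trans s0 st).
    by rewrite in_itv/= s0 (le_trans st tT).
  under eq_integral do rewrite lebesgue_stieltjes_measure_itvoc//.
  by rewrite EN// EFinM lebE.
apply: (@mean_measure_g_sigma_algebra _ _ _ _ _ P nu kappa (@ocitv R)) => //.
- exact: ocitvI.
- rewrite nuE setTI lebE//.
  by rewrite -EFinM ltry.
- move=> xi; rewrite kappaE setTI lebesgue_stieltjes_measure_itvoc//.
  by rewrite ltry.
- move=> {}U [[[a b] _ <-]|->]; first exact: kI.
  (* The whole line and []0, T]] have the same trace on []0, T]]. *)
  have [] := kI 0 T; rewrite !nuE setTI setIid.
  under eq_fun do rewrite kappaE setIid.
  move=> mk ->; split.
    by under eq_fun do rewrite kappaE setTI.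
  by apply: eq_integral => xi _; rewrite kappaE setTI.
Qed.

(** The almost sure integrability is recorded along with the mean because the solution formula is
    proved path by path and integrates [g] against individual trajectories. *)
Lemma campbell (g : R -> R) : leb.-integrable `]0, T] (EFin \o g) ->
  [/\ {ae P, forall xi,
         (lebesgue_stieltjes_measure (N xi)).-integrable `]0, T] (EFin \o g)},
      P.-integrable setT (fun xi =>
        (\int[lebesgue_stieltjes_measure (N xi)]_(s in `]0%R, T]) (g s)%:E)%E) &
      (\int[P]_xi \int[lebesgue_stieltjes_measure (N xi)]_(s in `]0%R, T]) (g s)%:E
       = lambda%:E * \int[leb]_(s in `]0%R, T]) (g s)%:E)%E].
Proof.
move=> gi.
have gi' := (integrable_mrestr leb mD _).2 gi.
have := integrable_mean_measure (fun U mU => (kappa_mean mU).1)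
  (fun U mU => (kappa_mean mU).2) (integrable_mscale (NngNum lambda0) gi').
rewrite integral_mscale// integral_mrestr/=.
have kE : (fun xi => \int[kappa xi]_y ((EFin \o g) \_ `]0%R, T]) y)%E =
    (fun xi => \int[lebesgue_stieltjes_measure (N xi)]_(s in `]0%R, T]) (g s)%:E)%E.
  by apply/funext => xi; rewrite integral_mrestr.
rewrite kE => -[aei int ->]; split => //.
by apply: filterS aei => xi /integrable_mrestr.
Qed.

End campbell.

End poisson_campbell.

(** * Matrix-valued integrals *)

Section matrix_integral.
Context (R : realType) d (Y : measurableType d).
Variables (mu : {measure set Y -> \bar R}).

(** Generic in the measure: it serves for Lebesgue measure, the Stieltjes measures of the counters,
    and [P]. *)
Definition mxintegrable (r c : nat) (D : set Y) (f : Y -> 'M[R]_(r, c)) :=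
  forall i j, mu.-integrable D (EFin \o (fun s => f s i j)).

Definition mxintegral (r c : nat) (D : set Y) (f : Y -> 'M[R]_(r, c)) :
    'M[R]_(r, c) := \matrix_(i, j) \int[mu]_(s in D) f s i j.

Lemma eq_mxintegral (r c : nat) (D : set Y) (f g : Y -> 'M[R]_(r, c)) :
  {in D, f =1 g} -> mxintegral D f = mxintegral D g.
Proof.
move=> fg; apply/matrixP => i j; rewrite !mxE.
by apply: eq_Rintegral => s sD; rewrite fg.
Qed.

Lemma eq_mxintegrable (r c : nat) (D : set Y) (f g : Y -> 'M[R]_(r, c)) :
  measurable D -> {in D, f =1 g} -> mxintegrable D f -> mxintegrable D g.
Proof.
move=> mD fg fi i j; apply: (eq_integrable mD _ _ _ (fi i j)) => s sD /=.
by rewrite fg.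
Qed.

Lemma mxintegrableS (r c : nat) (D E : set Y) (f : Y -> 'M[R]_(r, c)) :
  measurable D -> measurable E -> E `<=` D ->
  mxintegrable D f -> mxintegrable E f.
Proof. by move=> mD mE ED fi i j; exact: integrableS (fi i j). Qed.

Variables (D : set Y).
Hypothesis mD : measurable D.

Lemma integrable_sumr (I : finType) (h : I -> Y -> R) :
  (forall l, mu.-integrable D (EFin \o h l)) ->
  mu.-integrable D (EFin \o (fun s => \sum_l h l s)).
Proof.
move=> hi; rewrite (_ : EFin \o _ = (fun s => \sum_l (EFin \o h l) s)%E).
  by apply: integrable_sum.
by apply/funext => s /=; rewrite -sumEFin.
Qed.

Lemma Rintegral_sumr (I : finType) (h : I -> Y -> R) :
  (forall l, mu.-integrable D (EFin \o h l)) ->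
  \int[mu]_(s in D) (\sum_l h l s) = \sum_l \int[mu]_(s in D) h l s.
Proof.
move=> hi; rewrite /Rintegral; under eq_integral do rewrite -sumEFin.
rewrite integral_sum//= sum_fine// => l _.
exact: (integrable_fin_num mD (hi l)).
Qed.

Lemma mxintegrableD (r c : nat) (f g : Y -> 'M[R]_(r, c)) :
  mxintegrable D f -> mxintegrable D g ->
  mxintegrable D (fun s => f s + g s).
Proof.
move=> fi gi i j.
apply: (eq_integrable mD _ _ _ (integrableD mD (fi i j) (gi i j))) => s _ /=.
by rewrite mxE EFinD.
Qed.

Lemma mxintegralD (r c : nat) (f g : Y -> 'M[R]_(r, c)) :
  mxintegrable D f -> mxintegrable D g ->
  mxintegral D (fun s => f s + g s) = mxintegral D f + mxintegral D g.
Proof.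
move=> fi gi; apply/matrixP => i j; rewrite !mxE -RintegralD//.
by apply: eq_Rintegral => s _; rewrite mxE.
Qed.

Lemma mxintegrableB (r c : nat) (f g : Y -> 'M[R]_(r, c)) :
  mxintegrable D f -> mxintegrable D g ->
  mxintegrable D (fun s => f s - g s).
Proof.
move=> fi gi i j.
apply: (eq_integrable mD _ _ _ (integrableB mD (fi i j) (gi i j))) => s _ /=.
by rewrite !mxE EFinB.
Qed.

Lemma mxintegralB (r c : nat) (f g : Y -> 'M[R]_(r, c)) :
  mxintegrable D f -> mxintegrable D g ->
  mxintegral D (fun s => f s - g s) = mxintegral D f - mxintegral D g.
Proof.
move=> fi gi; apply/matrixP => i j; rewrite !mxE -RintegralB//.
by apply: eq_Rintegral => s _; rewrite !mxE.
Qed.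

Lemma mxintegrable_sum (I : finType) (r c : nat) (f : I -> Y -> 'M[R]_(r, c)) :
  (forall l, mxintegrable D (f l)) -> mxintegrable D (fun s => \sum_l f l s).
Proof.
move=> fi i j.
apply: (eq_integrable mD _ _ _ (integrable_sumr (fun l => fi l i j))) => s _ /=.
by rewrite summxE.
Qed.

Lemma mxintegral_sum (I : finType) (r c : nat) (f : I -> Y -> 'M[R]_(r, c)) :
  (forall l, mxintegrable D (f l)) ->
  mxintegral D (fun s => \sum_l f l s) = \sum_l mxintegral D (f l).
Proof.
move=> fi; apply/matrixP => i j; rewrite mxE summxE.
under [RHS]eq_bigr do rewrite mxE.
rewrite -Rintegral_sumr//; last by move=> l; exact: fi.
by apply: eq_Rintegral => s _; rewrite summxE.
Qed.

Lemma mxintegrable_mull (r p c : nat) (C : 'M[R]_(r, p)) (f : Y -> 'M[R]_(p, c)) :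
  mxintegrable D f -> mxintegrable D (fun s => C *m f s).
Proof.
move=> fi i j.
have hi l : mu.-integrable D (EFin \o (fun s => C i l * f s l j)).
  apply: (eq_integrable mD _ _ _ (integrableZl mD (C i l) (fi l j))) => s _ /=.
  by rewrite EFinM.
by apply: (eq_integrable mD _ _ _ (integrable_sumr hi)) => s _ /=; rewrite mxE.
Qed.

Lemma mxintegral_mull (r p c : nat) (C : 'M[R]_(r, p)) (f : Y -> 'M[R]_(p, c)) :
  mxintegrable D f ->
  mxintegral D (fun s => C *m f s) = C *m mxintegral D f.
Proof.
move=> fi; apply/matrixP => i j; rewrite !mxE.
under eq_Rintegral do rewrite mxE.
rewrite Rintegral_sumr; last first.
  move=> l; apply: (eq_integrable mD _ _ _ (integrableZl mD (C i l) (fi l j))).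
  by move=> s _ /=; rewrite EFinM.
by apply: eq_bigr => l _; rewrite mxE RintegralZl//; exact: fi.
Qed.

Lemma mxintegrable_mulr (r p c : nat) (C : 'M[R]_(p, c)) (f : Y -> 'M[R]_(r, p)) :
  mxintegrable D f -> mxintegrable D (fun s => f s *m C).
Proof.
move=> fi i j.
have hi l : mu.-integrable D (EFin \o (fun s => f s i l * C l j)).
  apply: (eq_integrable mD _ _ _ (integrableZl mD (C l j) (fi i l))) => s _ /=.
  by rewrite mulrC EFinM.
by apply: (eq_integrable mD _ _ _ (integrable_sumr hi)) => s _ /=; rewrite mxE.
Qed.

Lemma mxintegral_mulr (r p c : nat) (C : 'M[R]_(p, c)) (f : Y -> 'M[R]_(r, p)) :
  mxintegrable D f ->
  mxintegral D (fun s => f s *m C) = mxintegral D f *m C.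
Proof.
move=> fi; apply/matrixP => i j; rewrite !mxE.
under eq_Rintegral do rewrite mxE.
rewrite Rintegral_sumr; last first.
  move=> l; apply: (eq_integrable mD _ _ _ (integrableZl mD (C l j) (fi i l))).
  by move=> s _ /=; rewrite mulrC EFinM.
by apply: eq_bigr => l _; rewrite mxE RintegralZr//; exact: fi.
Qed.

Lemma mxintegrable_bounded_mull (r p c : nat) (C : Y -> 'M[R]_(r, p))
    (f : Y -> 'M[R]_(p, c)) :
  (forall i j, measurable_fun D (fun s => C s i j)) ->
  (forall i j, [bounded C s i j | s in D]) ->
  mxintegrable D f -> mxintegrable D (fun s => C s *m f s).
Proof.
move=> mC bC fi i j.
have hi l : mu.-integrable D (EFin \o (fun s => C s i l * f s l j)).
  apply: (eq_integrable mD _ _ _ (integrableMr mD (mC i l) (bC i l) (fi l j))).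
  by move=> s _ /=; rewrite EFinM.
by apply: (eq_integrable mD _ _ _ (integrable_sumr hi)) => s _ /=; rewrite mxE.
Qed.

End matrix_integral.

(** * Exchange of integrals over a triangle *)

Section fubini_triangle.
Context (R : realType).
Local Notation leb := (@lebesgue_measure R).
Local Notation mR := (measurableTypeR R).
Variables (nu : {sigma_finite_measure set (measurableTypeR R) -> \bar R}).
Variables (t : R) (a g : mR -> R).
Local Notation D := (`]0, t]%classic : set mR).
Hypotheses (ai : leb.-integrable D (EFin \o a))
  (gi : nu.-integrable D (EFin \o g)).

Let mD : measurable D. Proof. exact: measurable_itv. Qed.

Let mI (i : interval R) : measurable ([set` i] : set mR).
Proof. exact: measurable_itv. Qed.

(** The diagonal belongs to the triangle, and this matters: [nu] may have an atom at [s], which []0,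
    s]] counts. *)
Let le21 : set (mR * mR) := [set z | z.2 <= z.1].

Let f (z : mR * mR) : R := (a \_ D) z.1 * (g \_ D) z.2 * \1_le21 z.

Let maD : measurable_fun [set: mR] (a \_ D).
Proof.
by apply/(measurable_restrictT _ mD)/measurable_EFinP; exact: measurable_int ai.
Qed.

Let mgD : measurable_fun [set: mR] (g \_ D).
Proof.
by apply/(measurable_restrictT _ mD)/measurable_EFinP; exact: measurable_int gi.
Qed.

Let mag : measurable_fun setT (fun z : mR * mR => (a \_ D) z.1 * (g \_ D) z.2).
Proof.
apply: measurable_funM.
  exact: measurableT_comp maD measurable_fst.
exact: measurableT_comp mgD measurable_snd.
Qed.

Let mle21 : measurable le21.
Proof.
have : measurable_fun setT (fun z : mR * mR => z.2 - z.1).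
  by apply: measurable_funB; [exact: measurable_snd|exact: measurable_fst].
move=> /(_ measurableT _ (measurable_itv `]-oo, 0])).
rewrite setTI; congr (measurable _).
by apply/seteqP; split => z /=; rewrite in_itv/= subr_le0.
Qed.

Let iaD : leb.-integrable setT (EFin \o (a \_ D)).
Proof. by rewrite -restrict_EFin; exact: (integrable_mkcond (EFin \o a) mD).1. Qed.

Let igD : nu.-integrable setT (EFin \o (g \_ D)).
Proof. by rewrite -restrict_EFin; exact: (integrable_mkcond (EFin \o g) mD).1. Qed.

Let iag : (leb \x nu)%E.-integrable setT
  (EFin \o (fun z : mR * mR => (a \_ D) z.1 * (g \_ D) z.2)).
Proof.
apply/integrable12ltyP; first exact/measurable_EFinP.
rewrite /=; under eq_integral => x _.
  under eq_integral do rewrite normrM EFinM.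
  rewrite ge0_integralZl//; last first.
    by apply/measurable_EFinP; exact: measurableT_comp.
  over.
rewrite /= ge0_integralZr//.
- apply: lte_mul_pinfty => //.
  + exact: integral_ge0.
  + by have /integrableP[_] := integrable_norm iaD => _; rewrite integrable_fin_num//;
      exact: integrable_norm iaD.
  + by have /integrableP[_] := igD.
- by apply/measurable_EFinP; exact: measurableT_comp.
- exact: integral_ge0.
Qed.

Let iff : (leb \x nu)%E.-integrable setT (EFin \o f).
Proof.
apply: (le_integrable measurableT _ _ iag).
  exact/measurable_EFinP/measurable_funM.
move=> z _ /=; rewrite lee_fin /f normrM ler_piMr//.
by rewrite indicE; case: (z \in le21); rewrite ?normr1 ?normr0.
Qed.

Let FE s : D s -> fubini_F nu (EFin \o f) s =
  (a s * \int[nu]_(r in `]0, s]) g r)%:E.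
Proof.
move=> Ds; rewrite /fubini_F /=.
have sD : `]0, s] `<=` D.
  move=> r /=; rewrite !in_itv/= => /andP[-> rs].
  by move: Ds; rewrite /= in_itv/= => /andP[_]; exact: le_trans.
have -> : (fun r => (f (s, r))%:E) =
    (fun r => (a s)%:E * ((EFin \o g) \_ `]0%R, s]) r)%E.
  apply/funext => r; rewrite /f/= patchE (mem_set Ds) indicE !patchE.
  have [rs|rs] := boolP (r \in (`]0, s]%classic : set mR)).
    rewrite (mem_set (sD _ (set_mem rs))) (_ : _ \in le21) ?mulr1//.
    by move: rs; rewrite !inE /le21/= in_itv/= => /andP[].
  rewrite mule0; case: ifPn => rD; last by rewrite mulr0 mul0r.
  rewrite (_ : _ \in le21 = false) ?mulr0//.
  apply/negbTE; apply: contra rs; rewrite !inE /le21/= !in_itv/= => ->.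
  by move: rD; rewrite inE/= in_itv/= => /andP[->].
have igs : nu.-integrable `]0, s] (EFin \o g) by exact: integrableS gi.
rewrite integralZl//; last exact: (integrable_mkcond _ (mI _)).1 igs.
rewrite -integral_mkcond EFinM; congr (_ * _)%E.
by rewrite /Rintegral fineK//; exact: (integrable_fin_num (mI _) igs).
Qed.

Let F0 s : ~ D s -> fubini_F nu (EFin \o f) s = 0%E.
Proof.
move=> Ds; rewrite /fubini_F integral0_eq// => r _.
by rewrite /= /f/= patchE memNset// !mul0r.
Qed.

Let GE r : D r -> fubini_G leb (EFin \o f) r =
  ((\int[leb]_(s in `]r, t]) a s) * g r)%:E.
Proof.
move=> Dr; rewrite /fubini_G /=.
have rD : `[r, t] `<=` D.
  move=> s /=; rewrite !in_itv/= => /andP[rs ->].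
  move: Dr; rewrite /= in_itv/= => /andP[r0 _].
  by rewrite (lt_le_trans r0 rs).
have -> : (fun s => (f (s, r))%:E) =
    (fun s => ((EFin \o a) \_ `[r, t]) s * (g r)%:E)%E.
  apply/funext => s; rewrite /f/= [g \_ _]lock patchE -lock patchE (mem_set Dr).
  rewrite indicE patchE.
  have [rs|rs] := boolP (s \in (`[r, t]%classic : set mR)).
    rewrite (mem_set (rD _ (set_mem rs))) (_ : _ \in le21) ?mulr1//.
    by move: rs; rewrite !inE /le21/= in_itv/= => /andP[].
  rewrite mul0e; case: ifPn => sD; last by rewrite !mul0r.
  rewrite (_ : _ \in le21 = false) ?mulr0//.
  apply/negbTE; apply: contra rs; rewrite !inE /le21/= !in_itv/= => ->.
  by move: sD; rewrite inE/= in_itv/= => /andP[_ ->].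
have iar : leb.-integrable `[r, t] (EFin \o a) by exact: integrableS ai.
rewrite integralZr//; last exact: (integrable_mkcond _ (mI _)).1 iar.
rewrite -integral_mkcond EFinM; congr (_ * _)%E.
(* The section at [r] is the closed [[r, t]]; Lebesgue measure does not charge [r], so the interval
   may be opened there. *)
rewrite Rintegral_itv_obnd_cbnd; last first.
  apply: integrableS iar => //; apply: subset_itvr; rewrite bnd_simp//.
by rewrite /Rintegral fineK//; exact: (integrable_fin_num (mI _) iar).
Qed.

Let G0 r : ~ D r -> fubini_G leb (EFin \o f) r = 0%E.
Proof.
move=> Dr; rewrite /fubini_G integral0_eq// => s _.
by rewrite /= /f/= [X in _ * X * _]patchE memNset// mulr0 mul0r.
Qed.

Let FD : fubini_F nu (EFin \o f) =
  (EFin \o (fun s => a s * \int[nu]_(r in `]0, s]) g r)) \_ D.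
Proof.
apply/funext => s; rewrite patchE; case: ifPn; rewrite ?inE ?notin_setE.
  exact: FE.
exact: F0.
Qed.

Let GD : fubini_G leb (EFin \o f) =
  (EFin \o (fun r => (\int[leb]_(s in `]r, t]) a s) * g r)) \_ D.
Proof.
apply/funext => s; rewrite patchE; case: ifPn; rewrite ?inE ?notin_setE.
  exact: GE.
exact: G0.
Qed.

Lemma integrable_fubini_triangle1 :
  leb.-integrable D (EFin \o (fun s => a s * \int[nu]_(r in `]0, s]) g r)).
Proof.
apply/(integrable_mkcond _ mD); rewrite -FD.
exact: integrable_fubini_F iff.
Qed.

Lemma integrable_fubini_triangle2 :
  nu.-integrable D (EFin \o (fun r => (\int[leb]_(s in `]r, t]) a s) * g r)).
Proof.
apply/(integrable_mkcond _ mD); rewrite -GD.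
have mf : measurable_fun [set: mR * mR] (EFin \o f) := measurable_int _ iff.
apply/integrableP; split; first exact: measurable_fubini_G iff.
(* The modulus of the inner integral is at most the inner integral of [|f|], whose iterated integral
   is finite. *)
apply: le_lt_trans ((integrable21ltyP _ _ mf).1 iff).
apply: ge0_le_integral => //.
- by apply: measurableT_comp => //; exact: measurable_fubini_G iff.
- by apply: (measurable_fun_fubini_tonelli_G (abse \o (EFin \o f))) => //=;
    exact: measurableT_comp.
- move=> r _; apply: le_abse_integral => //.
  exact: measurableT_comp mf (measurable_pair2 _).
Qed.

Lemma fubini_triangle :
  \int[leb]_(s in D) (a s * \int[nu]_(r in `]0, s]) g r) =
  \int[nu]_(r in D) ((\int[leb]_(s in `]r, t]) a s) * g r).
Proof.
rewrite /Rintegral [in LHS]integral_mkcond [in RHS]integral_mkcond -FD -GD.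
by rewrite (integral12_prod_meas1 iff) (integral21_prod_meas1 iff).
Qed.

End fubini_triangle.

Section matrix_fubini.
Context (R : realType).
Local Notation leb := (@lebesgue_measure R).
Local Notation mR := (measurableTypeR R).
Variables (nu : {sigma_finite_measure set mR -> \bar R}) (t : R) (n p c : nat).
Variables (a : mR -> 'M[R]_(n, p)) (g : mR -> 'M[R]_(p, c)).
Hypotheses (ai : mxintegrable leb `]0, t] a) (gi : mxintegrable nu `]0, t] g).

Lemma mxintegrable_fubini_triangle1 :
  mxintegrable leb `]0, t] (fun s => a s *m mxintegral nu `]0, s] g).
Proof.
move=> i j.
have mD : measurable (`]0, t]%classic : set mR) by exact: measurable_itv.
have hi l := integrable_fubini_triangle1 (ai i l) (gi l j).
apply: (eq_integrable mD _ _ _ (integrable_sumr mD hi)) => s _ /=.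
by rewrite mxE; congr (_%:E); apply: eq_bigr => l _; rewrite mxE.
Qed.

Lemma mxintegrable_fubini_triangle2 :
  mxintegrable nu `]0, t] (fun r => mxintegral leb `]r, t] a *m g r).
Proof.
move=> i j.
have mD : measurable (`]0, t]%classic : set mR) by exact: measurable_itv.
have hi l := integrable_fubini_triangle2 (ai i l) (gi l j).
apply: (eq_integrable mD _ _ _ (integrable_sumr mD hi)) => s _ /=.
by rewrite mxE; congr (_%:E); apply: eq_bigr => l _; rewrite mxE.
Qed.

Lemma mxfubini_triangle :
  mxintegral leb `]0, t] (fun s => a s *m mxintegral nu `]0, s] g) =
  mxintegral nu `]0, t] (fun r => mxintegral leb `]r, t] a *m g r).
Proof.
have mD : measurable (`]0, t]%classic : set mR) by exact: measurable_itv.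
apply/matrixP => i j; rewrite !mxE.
transitivity (\sum_l \int[leb]_(s in `]0, t])
    (a s i l * \int[nu]_(r in `]0, s]) g r l j)).
  rewrite -Rintegral_sumr//; last first.
    by move=> l; exact: integrable_fubini_triangle1 (ai i l) (gi l j).
  apply: eq_Rintegral => s _; rewrite mxE; apply: eq_bigr => l _.
  by rewrite mxE.
under eq_bigr => l _ do rewrite (fubini_triangle (ai i l) (gi l j)).
rewrite -Rintegral_sumr//; last first.
  by move=> l; exact: integrable_fubini_triangle2 (ai i l) (gi l j).
apply: eq_Rintegral => r _; rewrite mxE; apply: eq_bigr => l _.
by rewrite mxE.
Qed.

End matrix_fubini.

(** * Uniqueness for the homogeneous integral equation *)

Section gronwall.
Context (R : realType).
Local Notation leb := (@lebesgue_measure R).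
Local Notation mR := (measurableTypeR R).

Lemma integral_expR (L t : R) : 0 < L -> 0 <= t ->
  (\int[leb]_(x in `]0%R, t]) (expR (L * x))%:E = (L^-1 * (expR (L * t) - 1))%:E)%E.
Proof.
move=> L0; rewrite le_eqVlt => /predU1P[<-|t0].
  by rewrite set_itvoc0 integral_set0 mulr0 expR0 subrr mulr0.
have L0' : L != 0 by rewrite gt_eqF.
have dL (x : R) : is_derive x 1 (fun y => L^-1 * expR (L * y)) (expR (L * x)).
  apply: is_derive_eq.
  by rewrite /GRing.scale/= mulr1; field.
have dd (x : R) : derivable (fun y => L^-1 * expR (L * y)) x 1.
  by case: (dL x).
have cE (x : R) : L^-1 * expR (L * y) @[y --> x] --> L^-1 * expR (L * x).
  apply: cvgMl_tmp; apply: (cvg_comp (fun y => L * y) expR).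
    exact: mulrl_continuous.
  exact: continuous_expR.
rewrite integral_itv_obnd_cbnd; last first.
  by apply/measurable_EFinP; apply: measurableT_comp => //; exact: mulrl_measurable.
rewrite (@continuous_FTC2 _ _ (fun y => L^-1 * expR (L * y))) => //.
- by rewrite mulr0 expR0 -EFinB -mulrBr.
- apply: continuous_subspaceT => x.
  by apply: continuous_comp; [exact: mulrl_continuous|exact: continuous_expR].
- split => //; [apply: cvg_at_right_filter|apply: cvg_at_left_filter]; exact: cE.
- by move=> x _; rewrite derive1E; case: (dL x) => _ ->.
Qed.

(** Let [S] be the supremum of [|D t i j| exp(-L t)]. The equation bounds [|D t i j|] by the
    integral of [n |C| S exp(L s)] over []0, t]], hence by [(n |C| / L) S exp(L t)]. For large [L]
    this yields [S <= S / 2], and [S = 0] follows once [S] is known to be finite. *)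
Lemma gronwall_uniqueness (n c : nat) (T : R) (A : mR -> 'M[R]_n)
    (D : mR -> 'M[R]_(n, c)) (C : R) :
  (forall i j, {ae leb, forall s, `]0, T]%classic s -> `|A s i j| <= C}) ->
  mxintegrable leb `]0, T] (fun s => A s *m D s) ->
  (forall t, t \in `[0, T] -> D t = mxintegral leb `]0, t] (fun s => A s *m D s)) ->
  forall t, t \in `[0, T] -> D t = 0.
Proof.
move=> AC iAD DE.
have mI (i : interval R) : measurable ([set` i] : set mR) by exact: measurable_itv.
have C0 : 0 < `|C| + 1 by rewrite ltr_wpDl.
(* The factor 2 produces the ratio 1/2; the two increments by 1 keep [L] positive even if [n = 0] or
   [C = 0]. *)
have [L L0 LE] : exists2 L : R, 0 < L & L = 2 * n.+1%:R * (`|C| + 1).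
  by eexists; last reflexivity; rewrite !mulr_gt0.
pose E : set R := [set x | exists t i j, t \in `[0, T] /\
  x = `|D t i j| * expR (- (L * t))].
have iADt t : t \in `[0, T] ->
    mxintegrable leb `]0, t] (fun s => A s *m D s).
  rewrite in_itv/= => /andP[_ tT]; apply: mxintegrableS iAD => //.
  by apply: subset_itvl; rewrite bnd_simp.
have Dle t i j : t \in `[0, T] ->
    (`|D t i j|%:E <= \int[leb]_(s in `]0%R, t]) `|(A s *m D s) i j|%:E)%E.
  move=> tT; rewrite DE// mxE EFin_normr_Rintegral//; last exact: iADt.
  apply: le_abse_integral => //; exact: measurable_int (iADt t tT i j).
have Eub : has_ubound E.
  (* The weight is at most 1, so each entry is bounded by its own integral of [|A D|] over []0, T]];
     summing over the entries gives a single bound. *)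
  exists (\sum_i \sum_j fine (\int[leb]_(s in `]0%R, T]) `|(A s *m D s) i j|%:E)%E).
  move=> _ [t [i [j [tT ->]]]].
  have fin k l : (\int[leb]_(s in `]0%R, T]) `|(A s *m D s) k l|%:E)%E \is a fin_num.
    exact: (integrable_fin_num (mI _) (integrable_norm (iAD k l))).
  have f0 k l : 0 <= fine (\int[leb]_(s in `]0%R, T]) `|(A s *m D s) k l|%:E)%E.
    by rewrite fine_ge0// integral_ge0.
  apply: (@le_trans _ _ (fine (\int[leb]_(s in `]0%R, T]) `|(A s *m D s) i j|%:E)%E)).
    rewrite (@le_trans _ _ (`|D t i j|))//.
      rewrite ler_piMr// -expR0 ler_expR oppr_le0 mulr_ge0 ?(ltW L0)//.
      by move: tT; rewrite in_itv/= => /andP[].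
    rewrite -lee_fin fineK//; apply: le_trans (Dle t i j tT) _.
    apply: ge0_subset_integral => //.
    + exact: (measurable_int leb (integrable_norm (iAD i j))).
    + move: tT; rewrite in_itv/= => /andP[_ tT].
      by apply: subset_itvl; rewrite bnd_simp.
  rewrite (bigD1 i)//= (bigD1 j)//= -addrA lerDl.
  by rewrite addr_ge0// sumr_ge0// => k _; rewrite sumr_ge0.
(* The supremum needs a nonempty set. If [E] is empty, there is no entry at any time to check. *)
have [E0|/set0P E0] := eqVneq E set0.
  move=> t tT; apply/matrixP => i j.
  suff : E (`|D t i j| * expR (- (L * t))) by rewrite E0.
  by exists t, i, j.
pose S := sup E.
have DS t i j : t \in `[0, T] -> `|D t i j| <= S * expR (L * t).
  move=> tT; rewrite -ler_pdivrMr ?expR_gt0// -expRN.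
  by apply: ub_le_sup => //; exists t, i, j.
have S0 : 0 <= S.
  have [x [t [i [j [tT _]]]]] := E0.
  have := DS t i j tT; rewrite -ler_pdivrMr ?expR_gt0//; apply: le_trans.
  by rewrite divr_ge0// expR_ge0.
have Dle2 t i j : t \in `[0, T] -> `|D t i j| <= S / 2 * expR (L * t).
  move=> tT; have t0 : 0 <= t by move: tT; rewrite in_itv/= => /andP[].
  have tT' : t <= T by move: tT; rewrite in_itv/= => /andP[].
  rewrite -lee_fin; apply: le_trans (Dle t i j tT) _.
  apply: (@le_trans _ _ (\int[leb]_(s in `]0%R, t])
      ((n%:R * `|C| * S)%:E * (expR (L * s))%:E))%E).
    apply: ae_ge0_le_integral => //.
    - exact: (measurable_int leb (integrable_norm (iADt t tT i j))).
    - by move=> s _; rewrite -EFinM lee_fin !mulr_ge0// expR_ge0.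
    - apply/measurable_EFinP/measurable_funM => //.
      by apply: measurableT_comp => //; exact: mulrl_measurable.
    - have : {ae leb, forall s, forall l : 'I_n,
          `]0, T]%classic s -> `|A s i l| <= C}.
        by apply: filter_forall => l; exact: AC.
      apply: (@filterS _ _ (ae_filter_ringOfSetsType leb)) => s As; rewrite /= in_itv/= => /andP[s0 st].
      have sT : s \in `[0, T] by rewrite in_itv/= ltW//= (le_trans st).
      rewrite -EFinM lee_fin mxE; apply: (le_trans (ler_norm_sum _ _ _)).
      rewrite -!mulrA mulr_natl -[X in _ *+ X]card_ord -sumr_const.
      apply: ler_sum => l _; rewrite normrM ler_pM ?DS//.
      rewrite (le_trans (As l _)) ?ler_norm//=.
      by rewrite in_itv/= s0 (le_trans st).
  rewrite ge0_integralZl//; last 2 first.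
    + by apply/measurable_EFinP; apply: measurableT_comp => //; exact: mulrl_measurable.
    + by rewrite lee_fin !mulr_ge0.
  rewrite integral_expR// -EFinM lee_fin.
  rewrite (@le_trans _ _ (n%:R * `|C| * S * (L^-1 * expR (L * t))))//.
    by rewrite ler_wpM2l ?mulr_ge0// ler_wpM2l ?invr_ge0 ?(ltW L0)// gerBl.
  rewrite mulrA ler_wpM2r ?expR_ge0// ler_pdivrMr//.
  rewrite LE (_ : S / 2 * _ = n.+1%:R * (`|C| + 1) * S); last by field.
  by rewrite ler_wpM2r// ler_pM// ?ler_nat// lerDl.
(* The weight makes the integral operator a contraction of factor 1/2. *)
have SS : S <= S / 2.
  apply: ge_sup => //= _ [t [i [j [tT ->]]]].
  by rewrite expRN ler_pdivrMr ?expR_gt0// Dle2.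
have SE : S = 0 by apply/eqP; rewrite eq_le S0 andbT; lra.
move=> t tT; apply/matrixP => i j; apply/eqP; rewrite mxE -normr_le0.
by have := DS t i j tT; rewrite SE mul0r.
Qed.

End gronwall.

(** * Linear equations in integral form *)

Section matrix_continuity.
Context (R : realType) (X : topologicalType).

Lemma continuous_sumr (I : Type) (r : seq I) (F : I -> X -> R) :
  (forall i, continuous (F i)) -> continuous (fun x => \sum_(i <- r) F i x).
Proof.
move=> cF; elim: r => [|i r IH].
  rewrite (_ : (fun x => _) = cst 0); first exact: cst_continuous.
  by apply/funext => x; rewrite big_nil.
rewrite (_ : (fun x => _) = F i \+ (fun x => \sum_(j <- r) F j x)).
  by move=> x; apply: continuousD; [exact: cF|exact: IH].
by apply/funext => x; rewrite big_cons.
Qed.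

Lemma continuous_prodr (I : Type) (r : seq I) (F : I -> X -> R) :
  (forall i, continuous (F i)) -> continuous (fun x => \prod_(i <- r) F i x).
Proof.
move=> cF; elim: r => [|i r IH].
  rewrite (_ : (fun x => _) = cst 1); first exact: cst_continuous.
  by apply/funext => x; rewrite big_nil.
rewrite (_ : (fun x => _) = F i \* (fun x => \prod_(j <- r) F j x)).
  by move=> x; apply: continuousM; [exact: cF|exact: IH].
by apply/funext => x; rewrite big_cons.
Qed.

Lemma continuous_det (n : nat) (F : X -> 'M[R]_n) :
  (forall i j, continuous (fun x => F x i j)) -> continuous (fun x => \det (F x)).
Proof.
move=> cF; apply: continuous_sumr => s x.
apply: cvgM; first exact: cvg_cst.
by apply: continuous_prodr => i; exact: cF.
Qed.

(** [G x] is the inverse of [F x], so by Cramer's rule its entries are cofactors of [F x] divided by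
    a determinant that never vanishes. *)
Lemma continuous_left_inverse (n : nat) (F G : X -> 'M[R]_n) :
  (forall i j, continuous (fun x => F x i j)) ->
  (forall x, F x *m G x = 1%:M) ->
  forall i j, continuous (fun x => G x i j).
Proof.
move=> cF FG i j.
have Fu x : F x \in unitmx by have [] := mulmx1_unit (FG x).
have -> : (fun x => G x i j) =
    (fun x => (\det (F x))^-1 * ((-1) ^+ (j + i) * \det (row' j (col' i (F x))))).
  apply/funext => x; have -> : G x = invmx (F x).
    by rewrite -[LHS]mul1mx -(mulVmx (Fu x)) -mulmxA FG mulmx1.
  by rewrite /invmx Fu !mxE.
move=> x; apply: cvgM.
  apply: cvgV; last exact: continuous_det.
  by have := Fu x; rewrite unitmxE unitfE.
apply: cvgM; first exact: cvg_cst.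
apply: continuous_det => k l.
by under eq_fun do rewrite !mxE; exact: cF.
Qed.

End matrix_continuity.

Section transition.
Context (R : realType).
Local Notation leb := (@lebesgue_measure R).
Local Notation mR := (measurableTypeR R).

Lemma mx_int0 (r c : nat) (t : R) (f : R -> 'M[R]_(r, c)) : 0 <= t ->
  mx_int 0 t f = mxintegral leb `]0, t] f.
Proof.
move=> t0; apply/matrixP => i j; rewrite !mxE.
by rewrite [X in _ - X](_ : _ = 0) ?subr0// set_itv_ge ?Rintegral_set0// bnd_simp -leNgt.
Qed.

(** Chasles' relation for the oriented integral. It moves the base point of the equation for
    [Phi t s] from [s] to [0], the form that Gronwall's lemma takes, whichever of [s] and [t] is
    larger. *)
Lemma mx_int_split (r c : nat) (T s t : R) (f : R -> 'M[R]_(r, c)) :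
  mx_integrable `[0, T] f -> s \in `[0, T] -> t \in `[0, T] ->
  mx_int s t f - mx_int s 0 f = mxintegral leb `]0, t] f.
Proof.
rewrite !in_itv/= => fi /andP[s0 sT] /andP[t0 tT].
apply/matrixP => i j; rewrite !mxE.
rewrite [X in _ - (X - _)](_ : _ = 0); last first.
  by rewrite set_itv_ge ?Rintegral_set0// bnd_simp -leNgt.
rewrite sub0r opprK.
have fiI (a b : R) : 0 <= a -> b <= T ->
    leb.-integrable `]a, b] (EFin \o (fun x => f x i j)).
  move=> a0 bT; apply: integrableS (fi i j) => //; try exact: measurable_itv.
  by apply: subset_itv; rewrite bnd_simp.
have [st|/ltW ts] := leP s t.
  rewrite [X in _ - X + _](_ : _ = 0); last first.
    by rewrite set_itv_ge ?Rintegral_set0// bnd_simp -leNgt.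
  rewrite subr0 -(@Rintegral_itvB _ _ (BRight 0) (BRight t) s) ?bnd_simp//.
    by rewrite subrK.
  exact: fiI.
rewrite [X in X - _ + _](_ : _ = 0); last first.
  by rewrite set_itv_ge ?Rintegral_set0// bnd_simp -leNgt.
rewrite sub0r addrC -(@Rintegral_itvB _ _ (BRight 0) (BRight s) t) ?bnd_simp//.
  by rewrite opprB addrC subrK.
exact: fiI.
Qed.

Variables (n : nat) (T C : R) (A : mR -> 'M[R]_n) (Phi : mR -> mR -> 'M[R]_n).
Hypotheses (T0 : 0 <= T)
  (AC : forall i j, {ae leb, forall s, `]0, T]%classic s -> `|A s i j| <= C})
  (HPhi : forall s, s \in `[0, T] ->
      mx_integrable `[0, T] (fun x => A x *m Phi x s) /\
      forall t, t \in `[0, T] ->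
        Phi t s = 1%:M + mx_int s t (fun x => A x *m Phi x s)).

Let mI (i : interval R) : measurable ([set` i] : set mR).
Proof. exact: measurable_itv. Qed.

Let zT : 0 \in `[0, T]. Proof. by rewrite in_itv/= lexx. Qed.

Let iAPhi s (a b : R) : s \in `[0, T] -> 0 <= a -> b <= T ->
  mxintegrable leb `]a, b] (fun x => A x *m Phi x s).
Proof.
move=> sT a0 bT.
apply: (@mxintegrableS _ _ _ leb _ _ (`[0, T]%classic : set mR)) => //.
- by apply: subset_itv; rewrite bnd_simp.
- by have [] := HPhi sT.
Qed.

Lemma transition_integral_eq t : t \in `[0, T] ->
  Phi t 0 = 1%:M + mxintegral leb `]0, t] (fun x => A x *m Phi x 0).
Proof.
move=> tT; have [_ /(_ t tT) ->] := HPhi zT.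
by rewrite mx_int0//; move: tT; rewrite in_itv/= => /andP[].
Qed.

(** As functions of [t], [Phi t 0 *m Phi 0 s] and [Phi t s] solve the same equation and agree at
    [t = 0]. They therefore agree at [t = s], where [Phi s s = 1]. *)
Lemma transition_matrixV s : s \in `[0, T] -> Phi s 0 *m Phi 0 s = 1%:M.
Proof.
move=> sT; have Pss : Phi s s = 1%:M.
  have [_ /(_ s sT) ->] := HPhi sT; rewrite (_ : mx_int _ _ _ = 0) ?addr0//.
  by apply/matrixP => i j; rewrite !mxE subrr.
apply/eqP; rewrite -Pss -subr_eq0; apply/eqP.
(* [D] solves the homogeneous equation with zero initial value. *)
pose D t := Phi t 0 *m Phi 0 s - Phi t s.
have DE x : A x *m D x = (A x *m Phi x 0) *m Phi 0 s - A x *m Phi x s.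
  by rewrite mulmxBr mulmxA.
apply: (@gronwall_uniqueness R n n T A D C AC) => //.
  apply: (eq_mxintegrable (mI _) (fun x _ => esym (DE x))).
  by apply: mxintegrableB => //; [apply: mxintegrable_mulr => //|]; exact: iAPhi.
move=> t tT; rewrite (eq_mxintegral _ (fun x _ => DE x)).
have [t0 tT'] : 0 <= t /\ t <= T by move: tT; rewrite in_itv/= => /andP.
rewrite mxintegralB//; last 2 first.
- by apply: mxintegrable_mulr => //; exact: iAPhi.
- exact: iAPhi.
rewrite mxintegral_mulr//; last exact: iAPhi.
have [iPs HPs] := HPhi sT.
rewrite -(mx_int_split iPs sT tT) /D transition_integral_eq// (HPs t tT) mulmxDl mul1mx.
have -> : mx_int s 0 (fun x => A x *m Phi x s) = Phi 0 s - 1%:M.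
  by rewrite (HPs 0 zT) addrC addKr.
by rewrite opprB -[_ - 1%:M - _]addrA -opprD [Phi 0 s + _]addrC -addrA.
Qed.


Let cF i j : {within `[0, T], continuous (fun t => Phi t 0 i j)}.
Proof.
apply: (@subspace_eq_continuous _ _ _ (fun t => (i == j)%:R +
  parameterized_integral leb 0 t (fun x => (A x *m Phi x 0) i j))).
  move=> t; rewrite inE => /[dup] tT /= /itvP t0T; rewrite /from_subspace.
  rewrite transition_integral_eq// !mxE; congr (_ + _).
  rewrite /parameterized_integral Rintegral_itv_obnd_cbnd//.
  by apply: iAPhi; rewrite ?t0T.
have : {within `[0, T], continuous (fun t =>
    parameterized_integral leb 0 t (fun x => (A x *m Phi x 0) i j))}.
  by apply: parameterized_integral_continuous => //; exact: (HPhi zT).1.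
by move=> cI x; apply: cvgD; [exact: cvg_cst|exact: cI].
Qed.

Let cV i j : {within `[0, T], continuous (fun t => Phi 0 t i j)}.
Proof.
(* Outside of [0, T] the matrices are unconstrained, so both are replaced by 1 there. *)
pose F (t : subspace (`[0, T]%classic : set R)) :=
  if t \in `[0, T] then Phi t 0 else 1%:M.
pose G (t : subspace (`[0, T]%classic : set R)) :=
  if t \in `[0, T] then Phi 0 t else 1%:M.
apply: (@subspace_eq_continuous _ _ _ (fun t => G t i j)).
  by move=> t; rewrite inE/= => tT; rewrite /from_subspace /G tT.
apply: (@continuous_left_inverse _ _ _ F G).
  move=> k l; apply: (@subspace_eq_continuous _ _ _ (fun t => Phi t 0 k l)).
    by move=> t; rewrite inE/= => tT; rewrite /from_subspace /F tT.
  exact: cF.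
move=> t; rewrite /F /G; case: ifPn => tT; last by rewrite mulmx1.
exact: transition_matrixV.
Qed.

Lemma measurable_transition_matrixV i j :
  measurable_fun (`[0, T] : set mR) (fun t => Phi 0 t i j).
Proof.
exact (subspace_continuous_measurable_fun (measurable_itv `[0, T]) (@cV i j)).
Qed.

Lemma bounded_transition_matrixV i j :
  [bounded Phi 0 t i j | t in (`[0, T] : set mR)].
Proof.
have /compact_bounded[M [_ mrt]] :=
  continuous_compact (@cV i j) (@segment_compact R 0 T).
exists M; split; rewrite ?num_real // => x Mx t tT.
by apply: (mrt x Mx); exists t.
Qed.

End transition.

(** * Variation of constants along one path *)

Section variation_of_constants.
Context (R : realType).
Local Notation leb := (@lebesgue_measure R).
Local Notation mR := (measurableTypeR R).
Variables (n : nat) (T C : R) (A : mR -> 'M[R]_n) (Phi : mR -> mR -> 'M[R]_n).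
Hypotheses (T0 : 0 <= T)
  (AC : forall i j, {ae leb, forall s, `]0, T]%classic s -> `|A s i j| <= C})
  (HPhi : forall s, s \in `[0, T] ->
      mx_integrable `[0, T] (fun x => A x *m Phi x s) /\
      forall t, t \in `[0, T] ->
        Phi t s = 1%:M + mx_int s t (fun x => A x *m Phi x s)).

Let mI (i : interval R) : measurable ([set` i] : set mR).
Proof. exact: measurable_itv. Qed.

Let zT : 0 \in `[0, T]. Proof. by rewrite in_itv/= lexx. Qed.

Let leT t : t \in `[0, T] -> `]0, t] `<=` `]0, T].
Proof.
by rewrite in_itv/= => /andP[_ tT]; apply: subset_itvl; rewrite bnd_simp.
Qed.

Let iS (nu : {measure set mR -> \bar R}) (r c : nat) (f : mR -> 'M[R]_(r, c)) t :
  t \in `[0, T] -> mxintegrable nu `]0, T] f -> mxintegrable nu `]0, t] f.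
Proof. by move=> tT; apply: mxintegrableS => //; exact: leT. Qed.

Let iAPhi : mxintegrable leb `]0, T] (fun x => A x *m Phi x 0).
Proof.
apply: (@mxintegrableS _ _ _ leb _ _ (`[0, T]%classic : set mR)) => //.
- by apply: subset_itv; rewrite bnd_simp.
- exact: (HPhi zT).1.
Qed.

(** On [[0, T]] the inverse [Phi 0 r] is measurable and bounded, so it preserves integrability
    against any measure, jump measures included. *)
Lemma mxintegrable_transition_matrixV (nu : {measure set mR -> \bar R}) (c : nat) (h : mR -> 'M[R]_(n, c)) :
  mxintegrable nu `]0, T] h -> mxintegrable nu `]0, T] (fun r => Phi 0 r *m h r).
Proof.
have sT : `]0, T] `<=` `[0, T] by apply: subset_itv; rewrite bnd_simp.
apply: mxintegrable_bounded_mull => // i j.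
  apply: (@measurable_funS _ _ _ _ (`[0, T]%classic : set mR)) => //.
  exact: measurable_transition_matrixV AC HPhi i j.
have [M [Mr MP]] := bounded_transition_matrixV T0 AC HPhi i j.
by exists M; split => // x Mx t tT; apply: MP => //; exact: sT.
Qed.

(* [V] is the response of the linear equation to the forcing [h dnu]; [nu] is
   either the Lebesgue measure (control) or the jump measure of a counter. *)
Section response.
Variables (nu : {sigma_finite_measure set mR -> \bar R}) (c : nat).
Variables (h : mR -> 'M[R]_(n, c)).
Hypothesis hi : mxintegrable nu `]0, T] h.

Let V t := Phi t 0 *m mxintegral nu `]0, t] (fun r => Phi 0 r *m h r).

Let AVE s : A s *m V s =
  (A s *m Phi s 0) *m mxintegral nu `]0, s] (fun r => Phi 0 r *m h r).
Proof. by rewrite mulmxA. Qed.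

Lemma mxintegrable_response : mxintegrable leb `]0, T] (fun s => A s *m V s).
Proof.
apply: (eq_mxintegrable (mI _) (fun x _ => esym (AVE x))).
by apply: mxintegrable_fubini_triangle1 => //; exact: mxintegrable_transition_matrixV.
Qed.

(** After the exchange of integrals the inner one is that of [A *m Phi x 0] over []r, t]], namely
    [Phi t 0 - Phi r 0]. Its first term rebuilds [V t]; in the second, [Phi r 0 *m Phi 0 r = 1]
    leaves [h r]. *)
Lemma response_integral_eq t : t \in `[0, T] ->
  V t = mxintegral leb `]0, t] (fun s => A s *m V s) + mxintegral nu `]0, t] h.
Proof.
move=> tT; have [t0 tT'] : 0 <= t /\ t <= T by move: tT; rewrite in_itv/= => /andP.
have ig := iS tT (mxintegrable_transition_matrixV hi).
rewrite (eq_mxintegral _ (fun x _ => AVE x)) mxfubini_triangle//; last exact: iS.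
apply/eqP; rewrite addrC -subr_eq; apply/eqP.
rewrite /V -mxintegral_mull// -mxintegralB//; last 2 first.
- exact: mxintegrable_mull.
- by apply: mxintegrable_fubini_triangle2 => //; exact: iS.
apply: eq_mxintegral => r; rewrite inE/= in_itv/= => /andP[r0 rt].
have rT : r \in `[0, T] by rewrite in_itv/= (ltW r0) (le_trans rt).
have -> : mxintegral leb `]r, t] (fun x => A x *m Phi x 0) = Phi t 0 - Phi r 0.
  rewrite (transition_integral_eq T0 HPhi tT) (transition_integral_eq T0 HPhi rT).
  rewrite opprD addrACA subrr add0r; apply/matrixP => i j; rewrite !mxE.
  rewrite -(@Rintegral_itvB _ _ (BRight 0) (BRight t) r) ?bnd_simp ?(ltW r0)//.
  exact: iS.
by rewrite mulmxBl opprB addrC subrK [Phi r 0 *m _]mulmxA (transition_matrixV T0 AC HPhi rT) mul1mx.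
Qed.

End response.

(** By linearity the candidate is the free motion plus one response per measure, so its difference
    [D] with [X] solves the homogeneous equation. The index [l] will run over the counters. *)
Lemma variation_of_constants (I : finType)
    (nu : I -> {sigma_finite_measure set mR -> \bar R})
    (h : I -> mR -> 'cV[R]_n) (f : mR -> 'cV[R]_n) (x0 : 'cV[R]_n) (X : mR -> 'cV[R]_n) :
  mxintegrable leb `]0, T] f ->
  (forall l, mxintegrable (nu l) `]0, T] (h l)) ->
  mx_integrable `[0, T] (fun s => A s *m X s + f s) ->
  (forall t, t \in `[0, T] -> X t = x0 + mx_int 0 t (fun s => A s *m X s + f s) +
    \sum_l mxintegral (nu l) `]0, t] (h l)) ->
  forall t, t \in `[0, T] -> X t = Phi t 0 *m
    (x0 + mxintegral leb `]0, t] (fun r => Phi 0 r *m f r) +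
     \sum_l mxintegral (nu l) `]0, t] (fun r => Phi 0 r *m h l r)).
Proof.
move=> fi hi iAXf XE t tT.
pose V (nu : {measure set mR -> \bar R}) (h : mR -> 'cV[R]_n) t :=
  Phi t 0 *m mxintegral nu `]0, t] (fun r => Phi 0 r *m h r).
pose D t := X t - (Phi t 0 *m x0 + V leb f t + \sum_l V (nu l) (h l) t).
(* [f] is added and subtracted because the hypothesis gives integrability of [A X + f] as one
   function. *)
have ADE s : A s *m D s = (A s *m X s + f s) -
    (f s + (A s *m Phi s 0 *m x0 + A s *m V leb f s + \sum_l A s *m V (nu l) (h l) s)).
  by rewrite /D mulmxBr !mulmxDr mulmxA mulmx_sumr
    [_ + f s]addrC [in RHS]opprD addrACA subrr add0r.
have iX : mxintegrable leb `]0, T] (fun s => A s *m X s + f s).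
  apply: (@mxintegrableS _ _ _ leb _ _ (`[0, T]%classic : set mR)) => //.
  by apply: subset_itv; rewrite bnd_simp.
have i1 : mxintegrable leb `]0, T] (fun s => A s *m Phi s 0 *m x0).
  exact: mxintegrable_mulr.
have i2 : mxintegrable leb `]0, T] (fun s => A s *m V leb f s).
  exact: (@mxintegrable_response leb).
have i3 l : mxintegrable leb `]0, T] (fun s => A s *m V (nu l) (h l) s).
  exact: mxintegrable_response.
have i12 := mxintegrableD (mI _) i1 i2.
have i3' := mxintegrable_sum (mI _) i3.
have i123 := mxintegrableD (mI _) i12 i3'.
have if123 := mxintegrableD (mI _) fi i123.
suff : D t = 0.
  move/eqP; rewrite subr_eq0 => /eqP ->.
  by rewrite !mulmxDr mulmx_sumr.
apply: (gronwall_uniqueness AC _ _ tT).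
  apply: (eq_mxintegrable (mI _) (fun x _ => esym (ADE x))).
  exact: mxintegrableB.
move=> {tT}t tT; rewrite (eq_mxintegral _ (fun x _ => ADE x)).
rewrite (mxintegralB (mI _) (iS tT iX) (iS tT if123)).
rewrite (mxintegralD (mI _) (iS tT fi) (iS tT i123)).
rewrite (mxintegralD (mI _) (iS tT i12) (iS tT i3')).
rewrite (mxintegralD (mI _) (iS tT i1) (iS tT i2)).
rewrite (mxintegral_sum (mI _) (fun l => iS tT (i3 l))).
rewrite (mxintegral_mulr (mI _) _ (iS tT iAPhi)).
have t0 : 0 <= t by move: tT; rewrite in_itv/= => /andP[].
rewrite {1}/D XE// mx_int0//.
rewrite (transition_integral_eq T0 HPhi tT) mulmxDl mul1mx.
rewrite [V leb f t](@response_integral_eq leb _ _ fi _ tT).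
under [X in _ - (_ + X) = _]eq_bigr => l _ do
  rewrite [V _ _ _](response_integral_eq (hi l) tT).
rewrite big_split/=.
set a := mxintegral leb _ (fun x => _ + _).
set b := mxintegral leb _ (fun x => _ *m Phi x 0) *m _.
set e := mxintegral leb _ f.
set p := mxintegral leb _ _.
set q := \sum_l mxintegral (nu l) _ _.
set w := \sum_l mxintegral leb _ _.
apply/matrixP => i j; rewrite !mxE; ring.
Qed.

End variation_of_constants.

(** * Sections of the coefficients at almost every parameter *)

Section parameter_sections.
Context (R : realType).
Local Notation leb := (@lebesgue_measure R).
Local Notation mR := (measurableTypeR R).

Lemma ae_ysection d1 d2 (T1 : measurableType d1) (T2 : measurableType d2)
    (m1 : {sigma_finite_measure set T1 -> \bar R})
    (m2 : {sigma_finite_measure set T2 -> \bar R}) (Q : T1 * T2 -> Prop) :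
  {ae (m1 \x m2)%E, forall z, Q z} ->
  {ae m2, forall y, {ae m1, forall x, Q (x, y)}}.
Proof.
move=> [N [mN N0 QN]].
have mN2 : measurable_fun setT (m1 \o ysection N) by exact: measurable_fun_ysection.
have : (\int[m2]_y `|(m1 \o ysection N) y|)%E = 0%E.
  under eq_integral do rewrite gee0_abs//.
  (* [m1 \x m2] is built from sections at fixed first coordinate; uniqueness of the product measure
     allows integrating the sections at fixed [y] instead. *)
  rewrite -[LHS]/((m1 \x^ m2)%E N) -N0; apply/esym.
  apply: product_measure_unique => // A B mA mB.
  exact: product_measure2E.
move/(ae_eq_integral_abs _ measurableT mN2).
apply: filterS => y /(_ Logic.I) /= my.
exists (ysection N y); split => //; first exact: measurable_ysection.
by move=> x /= nQ; rewrite /ysection/= inE; exact: (QN (x, y)).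
Qed.

(** An essential bound on the product domain passes to almost every section with the same constant;
    the sum of the moduli of the entries' constants serves all entries. *)
Lemma Lp_domain_oo_bounded (T : R) (K : set R) (r c : nat)
    (f : R -> R -> 'M[R]_(r, c)) : Lp_domain +oo%E T K f ->
  exists C, {ae leb, forall b, K b ->
    forall i j, {ae leb, forall s, `]0, T]%classic s -> `|f s b i j| <= C}}.
Proof.
move=> fL.
have H i j : exists C : R, {ae leb, forall b,
    {ae leb, forall s, `]0, T]%classic s -> K b -> `|f s b i j| <= C}}.
  pose g := (fun z : mR * mR => f z.1 z.2 i j) \_ (`[0, T] `*` K).
  have : exists C : R, {ae (leb \x leb)%E, forall z, `|g z| <= C}.
    have := fL i j; rewrite inE => /andP[_]; rewrite inE/= /finite_norm unlock.
    case: ifPn => [_|m0 _].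
      exact: (@ess_supr_bounded _ _ _ (leb \x leb)%E (Num.norm \o g)).
    (* Degenerate branch of the essential supremum norm: the whole space is null, so any bound holds
       almost everywhere. *)
    exists 0; exists setT; split => //.
    by apply/eqP; rewrite -measure_le0 leNgt.
  move=> [C /ae_ysection gC]; exists C.
  apply: filterS gC => b; apply: filterS => s; rewrite /g patchE => gsC s0T Kb.
  move: gsC; rewrite mem_set//; split => //=.
  by move: s0T; rewrite /= !in_itv/= => /andP[/ltW -> ->].
have [C HC] := choice (fun ij : 'I_r * 'I_c => H ij.1 ij.2).
exists (\sum_ij `|C ij|).
have : {ae leb, forall b, forall ij : 'I_r * 'I_c,
    {ae leb, forall s, `]0, T]%classic s -> K b -> `|f s b ij.1 ij.2| <= C ij}}.
  by apply: filter_forall => ij; exact: HC.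
apply: (@filterS _ _ (ae_filter_ringOfSetsType leb)) => b fb Kb i j.
apply: (@filterS _ _ (ae_filter_ringOfSetsType leb)) (fb (i, j)) => s /[apply] /(_ Kb) /=.
move=> /le_trans; apply; rewrite (bigD1 (i, j))//=.
by rewrite (le_trans (ler_norm _))// lerDl sumr_ge0.
Qed.

(** Membership in L2 for the representative itself on [D], not for its extension by 0. Measurability
    is listed because integrability of the square does not imply it. *)
Definition square_integrable (r c : nat) (D : set mR) (f : mR -> 'M[R]_(r, c)) :=
  forall i j, measurable_fun D (fun s => f s i j) /\
    leb.-integrable D (EFin \o (fun s => f s i j ^+ 2)).

(** Fubini applied to the squares of the entries. *)
Lemma Lp_domain2_square_integrable (T : R) (K : set R) (r c : nat)
    (f : R -> R -> 'M[R]_(r, c)) : Lp_domain 2%:E T K f ->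
  {ae leb, forall b, K b -> square_integrable `]0, T] (f ^~ b)}.
Proof.
move=> fL.
have mD : measurable (`]0, T]%classic : set mR) by exact: measurable_itv.
have : {ae leb, forall b, forall ij : 'I_r * 'I_c, leb.-integrable setT
   (EFin \o (fun s : mR => (((fun z : mR * mR => f z.1 z.2 ij.1 ij.2) \_
      (`[0, T] `*` K)) (s, b)) ^+ 2))}.
  apply: filter_forall => ij.
  exact: ae_integrable2 (Lfun2_integrable_sqr (fL ij.1 ij.2)).
apply: (@filterS _ _ (ae_filter_ringOfSetsType leb)) => b fb Kb i j.
have gE (s : mR) : s \in (`]0, T]%classic : set mR) ->
    ((fun z : mR * mR => f z.1 z.2 i j) \_ (`[0, T] `*` K)) (s, b) = f s b i j.
  rewrite inE/= => s0T; rewrite patchE mem_set//; split => //=.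
  by move: s0T; rewrite !in_itv/= => /andP[/ltW -> ->].
split.
  apply: (eq_measurable_fun (fun s : mR =>
      ((fun z : mR * mR => f z.1 z.2 i j) \_ (`[0, T] `*` K)) (s, b))) => //.
  have := fL i j; rewrite inE => /andP[+ _]; rewrite inE/= => mf.
  apply: (@measurable_funS _ _ _ _ setT) => //.
  exact: (measurableT_comp mf (measurable_pair2 b)).
apply: (eq_integrable mD _ _ _ (integrableS measurableT mD _ (fb (i, j)))) => //.
by move=> s sD /=; rewrite gE.
Qed.

Lemma Lp_itv2_square_integrable (T : R) (r c : nat) (f : R -> 'M[R]_(r, c)) :
  Lp_itv 2%:E T f -> square_integrable `]0, T] f.
Proof.
move=> fL i j.
have mD : measurable (`]0, T]%classic : set mR) by exact: measurable_itv.
have gE (s : mR) : s \in (`]0, T]%classic : set mR) ->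
    ((fun t : mR => f t i j) \_ `[0, T]) s = f s i j.
  rewrite inE/= => s0T; rewrite patchE mem_set//=.
  by move: s0T; rewrite !in_itv/= => /andP[/ltW -> ->].
split.
  apply: (eq_measurable_fun ((fun t : mR => f t i j) \_ `[0, T])) => //.
  have := fL i j; rewrite inE => /andP[+ _]; rewrite inE/= => mf.
  exact: (@measurable_funS _ _ _ _ setT).
apply: (eq_integrable mD _ _ _
  (integrableS measurableT mD _ (Lfun2_integrable_sqr (fL i j)))) => //.
by move=> s sD /=; rewrite gE.
Qed.

(** From [|x y| <= x^2 + y^2]; this makes [B u] integrable in time. *)
Lemma square_integrable_mul (r p c : nat) (D : set mR) (f : mR -> 'M[R]_(r, p))
    (g : mR -> 'M[R]_(p, c)) : measurable D ->
  square_integrable D f -> square_integrable D g ->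
  mxintegrable leb D (fun s => f s *m g s).
Proof.
move=> mD f2 g2 i j.
have hi l : leb.-integrable D (EFin \o (fun s => f s i l * g s l j)).
  have [mf if2] := f2 i l; have [mg ig2] := g2 l j.
  apply: (le_integrable mD _ _ (integrableD mD if2 ig2)).
    by apply/measurable_EFinP; exact: measurable_funM.
  move=> s _ /=; rewrite lee_fin [leRHS]ger0_norm ?addr_ge0 ?sqr_ge0//.
  rewrite normrM -(normr_id (f s i l)) -[X in X + _]real_normK ?num_real//.
  rewrite -[X in _ + X]real_normK ?num_real// normr_id.
  by nra.
by apply: (eq_integrable mD _ _ _ (integrable_sumr mD hi)) => s _ /=; rewrite mxE.
Qed.

(** From [|x| <= 1 + x^2] on an interval of finite length. *)
Lemma square_integrable_integrable (r c : nat) (T : R) (f : mR -> 'M[R]_(r, c)) :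
  square_integrable `]0, T] f -> mxintegrable leb `]0, T] f.
Proof.
move=> f2 i j; have [mf if2] := f2 i j.
have mD : measurable (`]0, T]%classic : set mR) by exact: measurable_itv.
have i1 : leb.-integrable `]0, T] (EFin \o cst 1).
  apply: measurable_bounded_integrable => //.
    by rewrite /= lebesgue_measure_itv/=; case: ifPn; rewrite ?ltry// -EFinB ltry.
  by exists 1; split; rewrite ?num_real// => x x1 s _ /=; rewrite normr1 ltW.
apply: (le_integrable mD _ _ (integrableD mD i1 if2)); first exact/measurable_EFinP.
move=> s _ /=; rewrite lee_fin [leRHS]ger0_norm ?addr_ge0 ?sqr_ge0//.
by rewrite -[X in 1 + X]real_normK ?num_real//; nra.
Qed.

End parameter_sections.

(** * The mean of the terminal state *)

Section expectations.
Context (R : realType) d (Xi : measurableType d).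
Local Notation leb := (@lebesgue_measure R).

(** Campbell's formula has extended real inner integrals, while [mxintegral] takes their [fine]
    part; the two differ only on a null set. *)
Lemma integrable_fine (P : {measure set Xi -> \bar R}) (h : Xi -> \bar R) :
  P.-integrable setT h -> P.-integrable setT (EFin \o (fine \o h)) /\
  (\int[P]_xi (fine (h xi))%:E = \int[P]_xi h xi)%E.
Proof.
move=> hi; have mh := measurable_int P hi.
have mf : measurable_fun setT (EFin \o (fine \o h)).
  by apply/measurable_EFinP; exact: measurableT_comp.
split.
  apply: (le_integrable measurableT mf _ hi) => xi _ /=.
  by case: (h xi) => [r| |] //=; rewrite normr0 ?leey ?le0y.
apply: ae_eq_integral => //.
apply: filterS (integrable_ae measurableT hi) => xi /(_ Logic.I) hfin _ /=.
by rewrite fineK.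
Qed.

Lemma campbell_mx (P : probability Xi R) (T lambda : R)
    (N : Xi -> cumulative R R) (r c : nat) (g : measurableTypeR R -> 'M[R]_(r, c)) :
  0 <= T -> poisson_counter P T lambda N -> mxintegrable leb `]0, T] g ->
  [/\ {ae P, forall xi,
        mxintegrable (lebesgue_stieltjes_measure (N xi)) `]0, T] g},
      mxintegrable P setT (fun xi =>
        mxintegral (lebesgue_stieltjes_measure (N xi)) `]0, T] g) &
      mxintegral P setT (fun xi =>
        mxintegral (lebesgue_stieltjes_measure (N xi)) `]0, T] g) =
      lambda *: mxintegral leb `]0, T] g].
Proof.
move=> T0 NP gi.
have mD : measurable (`]0, T]%classic : set (measurableTypeR R)).
  exact: measurable_itv.
split.
- have : {ae P, forall xi, forall ij : 'I_r * 'I_c,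
      (lebesgue_stieltjes_measure (N xi)).-integrable `]0, T]
        (EFin \o (fun s => g s ij.1 ij.2))}.
    by apply: filter_forall => ij; have [] := campbell T0 NP (gi ij.1 ij.2).
  by apply: filterS => xi gxi i j; exact: gxi (i, j).
- move=> i j; have [_ /integrable_fine[+ _] _] := campbell T0 NP (gi i j).
  apply: (eq_integrable measurableT) => xi _ /=.
  by rewrite mxE.
- apply/matrixP => i j; rewrite !mxE.
  have [_ /integrable_fine[_ E1] E2] := campbell T0 NP (gi i j).
  rewrite {1}/Rintegral; under eq_integral do rewrite mxE.
  rewrite [X in fine X]E1 E2 fineM//.
  exact: (integrable_fin_num mD (gi i j)).
Qed.

Lemma mxintegral_cst (P : probability Xi R) (r c : nat) (C : 'M[R]_(r, c)) :
  mxintegral P setT (fun=> C) = C.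
Proof.
apply/matrixP => i j; rewrite mxE.
by rewrite Rintegral_cst// [X in fine X](probability_setT P) mulr1.
Qed.

Lemma mxintegrable_cst (P : probability Xi R) (r c : nat) (C : 'M[R]_(r, c)) :
  mxintegrable P setT (fun=> C).
Proof. by move=> i j; exact: finite_measure_integrable_cst. Qed.

(** [P] need not be complete, so measurability of [f] has to be supplied; for the state it comes
    from adaptedness. *)
Lemma ae_eq_mxintegral (P : {measure set Xi -> \bar R}) (r c : nat)
    (f g : Xi -> 'M[R]_(r, c)) :
  (forall i j, measurable_fun setT (fun xi => f xi i j)) ->
  mxintegrable P setT g -> {ae P, forall xi, f xi = g xi} ->
  mxintegral P setT f = mxintegral P setT g.
Proof.
move=> mf gi fg; apply/matrixP => i j; rewrite !mxE; congr fine.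
apply: ae_eq_integral => //.
- exact/measurable_EFinP.
- exact: measurable_int (gi i j).
- by apply: filterS fg => xi + _ /=; move=> ->.
Qed.

Lemma adapted_at_measurable (P : probability Xi R) (k : nat)
    (N : 'I_k -> Xi -> cumulative R R) (t : R) (Y : Xi -> R) :
  adapted_at P N t Y -> measurable_fun setT Y.
Proof. by move=> aY _ B mB; apply: (aY _ _).1; exists B. Qed.

Lemma mean_stateE (P : probability Xi R) (n : nat)
    (X : R -> R -> Xi -> 'cV[R]_n) (t b : R) :
  mean_state P X t b = mxintegral P setT (X t b).
Proof.
apply/matrixP => i j; rewrite !mxE ord1 /Rintegral.
by rewrite unlock.
Qed.

(** Column [j] is driven by counter [j] alone: this is the finite family of forcings of
    [variation_of_constants]. *)
Lemma jump_intE (n k : nat) (N : 'I_k -> Xi -> cumulative R R) (xi : Xi) (t : R)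
    (g : R -> 'M[R]_(n, k)) :
  jump_int N xi t g = \sum_j
    mxintegral (lebesgue_stieltjes_measure (N j xi)) `]0, t] (fun s => col j (g s)).
Proof.
apply/matrixP => i j; rewrite ord1 mxE summxE; apply: eq_bigr => l _.
by rewrite mxE; apply: eq_Rintegral => s _; rewrite mxE.
Qed.

End expectations.

Section mean_of_solution.
Context (R : realType) d (Xi : measurableType d) (P : probability Xi R).
Local Notation leb := (@lebesgue_measure R).
Local Notation mR := (measurableTypeR R).

Lemma variation_of_constants_mean (n k : nat) (T C : R) (A : mR -> 'M[R]_n)
    (G : mR -> 'M[R]_(n, k)) (lambda : 'cV[R]_k) (N : 'I_k -> Xi -> cumulative R R)
    (Phi : mR -> mR -> 'M[R]_n) (f : mR -> 'cV[R]_n) (x0 : 'cV[R]_n)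
    (X : mR -> Xi -> 'cV[R]_n) :
  0 <= T -> (forall j, poisson_counter P T (lambda j 0) (N j)) ->
  (forall i j, {ae leb, forall s, `]0, T]%classic s -> `|A s i j| <= C}) ->
  (forall s, s \in `[0, T] ->
      mx_integrable `[0, T] (fun x => A x *m Phi x s) /\
      forall t, t \in `[0, T] ->
        Phi t s = 1%:M + mx_int s t (fun x => A x *m Phi x s)) ->
  mxintegrable leb `]0, T] f -> mxintegrable leb `]0, T] G ->
  (forall i, measurable_fun setT (fun xi => X T xi i 0)) ->
  {ae P, forall xi,
      mx_integrable `[0, T] (fun s => A s *m X s xi + f s) /\
      forall t, t \in `[0, T] ->
        X t xi = x0 + mx_int 0 t (fun s => A s *m X s xi + f s)
                   + jump_int N xi t G} ->
  mxintegral P setT (X T) =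
    Phi T 0 *m (x0 + mxintegral leb `]0, T] (fun s => Phi 0 s *m (f s + G s *m lambda))).
Proof.
move=> T0 NP AC HPhi fi Gi mX HX.
have TT : T \in `[0, T] by rewrite in_itv/= T0 lexx.
have mD : measurable (`]0, T]%classic : set mR) by exact: measurable_itv.
pose h j s := col j (G s).
have hi j : mxintegrable leb `]0, T] (h j).
  by move=> i l; apply: (eq_integrable mD _ _ _ (Gi i j)) => s _ /=; rewrite mxE.
have ghi j := mxintegrable_transition_matrixV T0 AC HPhi (hi j).
pose Y j xi := mxintegral (lebesgue_stieltjes_measure (N j xi)) `]0, T]
  (fun s => Phi 0 s *m h j s).
have Yi j : mxintegrable P setT (Y j) by have [] := campbell_mx T0 (NP j) (ghi j).
have YE j : mxintegral P setT (Y j) =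
    lambda j 0 *: mxintegral leb `]0, T] (fun s => Phi 0 s *m h j s).
  by have [] := campbell_mx T0 (NP j) (ghi j).
pose c := x0 + mxintegral leb `]0, T] (fun r => Phi 0 r *m f r).
have XY : {ae P, forall xi, X T xi = Phi T 0 *m (c + \sum_j Y j xi)}.
  (* Campbell's formula is used twice: for [Phi 0 s *m h j s] it gives the means [YE], for [h j] the
     pathwise integrability required by the solution formula. *)
  have hNi : {ae P, forall xi, forall j,
      mxintegrable (lebesgue_stieltjes_measure (N j xi)) `]0, T] (h j)}.
    by apply: filter_forall => j; have [] := campbell_mx T0 (NP j) (hi j).
  apply: filterS2 HX hNi => xi [iX XE] hNxi.
  apply: (@variation_of_constants R n T C A Phi T0 AC HPhi 'I_k
    (fun j => lebesgue_stieltjes_measure (N j xi)) h f x0 (X ^~ xi) fi hNxi iX _ T TT).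
  by move=> t tT; rewrite XE// jump_intE.
have cYi : mxintegrable P setT (fun xi => c + \sum_j Y j xi).
  apply: mxintegrableD => //; first exact: mxintegrable_cst.
  exact: mxintegrable_sum.
rewrite (ae_eq_mxintegral _ _ XY); last 2 first.
- by move=> i j; rewrite ord1; exact: mX.
- exact: mxintegrable_mull.
rewrite mxintegral_mull// mxintegralD//; last 2 first.
- exact: mxintegrable_cst.
- exact: mxintegrable_sum.
rewrite mxintegral_cst mxintegral_sum// /c -addrA; congr (_ *m (_ + _)).
(* Each intensity is written as a 1 by 1 scalar matrix, so that it can be pulled out of the integral
   as a constant right factor. *)
have fhE s : Phi 0 s *m (f s + G s *m lambda) =
    Phi 0 s *m f s + \sum_j Phi 0 s *m h j s *m (lambda j 0)%:M.
  rewrite mulmxDr; congr (_ + _).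
  rewrite (_ : G s *m lambda = \sum_j h j s *m (lambda j 0)%:M); last first.
    apply/matrixP => i z; rewrite ord1 !mxE summxE; apply: eq_bigr => j _.
    by rewrite mul_mx_scalar !mxE mulrC.
  by rewrite mulmx_sumr; apply: eq_bigr => j _; rewrite mulmxA.
rewrite (eq_mxintegral _ (fun s _ => fhE s)) mxintegralD//; last 2 first.
- exact: mxintegrable_transition_matrixV fi.
- by apply: mxintegrable_sum => // j; exact: mxintegrable_mulr.
congr (_ + _); rewrite mxintegral_sum//; last by move=> j; exact: mxintegrable_mulr.
apply: eq_bigr => j _.
by rewrite mxintegral_mulr// mul_mx_scalar YE.
Qed.

End mean_of_solution.

Unset Implicit Arguments.
Set Strict Implicit.

Theorem proposition7 (R : realType) (d : measure_display)
    (Xi : measurableType d) (P : probability Xi R) (n m k : nat)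
    (T : R) (K : set R) (M : set 'cV[R]_n) (U : set 'cV[R]_m)
    (A : R -> R -> 'M[R]_n) (B : R -> R -> 'M[R]_(n, m))
    (G : R -> R -> 'M[R]_(n, k))
    (lambda : 'cV[R]_k) (N : 'I_k -> Xi -> cumulative R R)
    (Phi : R -> R -> R -> 'M[R]_n)
    (X0 XF : R -> 'cV[R]_n)
    (u : R -> 'cV[R]_m) (X : R -> R -> Xi -> 'cV[R]_n)
    (T_gt0 : 0 < T) (K_compact : compact K)
    (A_Loo : Lp_domain +oo%E T K A)
    (B_L2 : Lp_domain 2%:E T K B)
    (G_L2 : Lp_domain 2%:E T K G)
    (N_poisson : poisson_counters P T lambda N)
    (Phi_transition : transition_matrix T K A Phi)
    (X0_HK : Lp_params 2%:E K X0) (XF_HK : Lp_params 2%:E K XF)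
    (u_opt : minimizes_J1_steering P T K M U A B G N X0 XF u X) :
  \forall b \ae @lebesgue_measure R, K b ->
    mx_int 0 T (fun s => Phi 0 s b *m (B s b *m u s + G s b *m lambda)) =
      Phi 0 T b *m XF b - X0 b.
Proof.
have T0 := ltW T_gt0; have [NP _] := N_poisson.
have [[[u2 _] Xsol XmF] _] := u_opt.
have TT : T \in `[0, T] by rewrite in_itv/= T0 lexx.
have mD : measurable (`]0, T]%classic : set (measurableTypeR R)).
  exact: measurable_itv.
have [C AC] := Lp_domain_oo_bounded A_Loo.
have B2 := Lp_domain2_square_integrable B_L2.
have G2 := Lp_domain2_square_integrable G_L2.
have {}u2 := Lp_itv2_square_integrable u2.
have aeF := ae_filter_ringOfSetsType (@lebesgue_measure R).
(* All exceptional null sets of parameters are discarded at once: those of the sections of [A], [B],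
   [G] and those in the notions of transition matrix, solution and steering. *)
apply: (@filterS3 _ _ aeF _ _ _ _ _ AC (filterI B2 G2) (filterI Phi_transition (filterI Xsol XmF))).
move=> b AC' [B2' G2'] [HPhi' [Xsol' XmF']] Kb.
have {}AC := AC' Kb; have {}B2 := B2' Kb; have {}G2 := G2' Kb.
have HPhi := HPhi' Kb; have [Xad {}Xsol] := Xsol' Kb; have {}XmF := XmF' Kb.
have fi := square_integrable_mul mD B2 u2.
have Gi := square_integrable_integrable G2.
have mX i : measurable_fun setT (fun xi => X T b xi i 0).
  exact: adapted_at_measurable (Xad T i TT).
have := @variation_of_constants_mean R d Xi P n k T C (A ^~ b) (G ^~ b) lambda N
  (fun t s => Phi t s b) (fun s => B s b *m u s) (X0 b) (fun t xi => X t b xi)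
  T0 NP AC HPhi fi Gi mX.
(* [XF b] is replaced by [Phi T 0 b] applied to [X0 b] plus the integral; [Phi 0 T b] then cancels
   the leading factor, a right inverse of a square matrix being also a left inverse. *)
rewrite -mean_stateE XmF => ->; last first.
  apply: filterS Xsol => xi [iX XE]; split => // t tT.
  by have [_ ->] := XE t tT.
rewrite mx_int0// mulmxA (mulmx1C (transition_matrixV T0 AC HPhi TT)) mul1mx.
by rewrite addrC addKr.
Qed.
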